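(* Let $B_w$ be a bounded weighted shift on $\ell^p(\mathbb{N})$, $1\leq p < +\infty$, and let $\Lambda \subset (0,+\infty)$ be a non-empty set. Then: (1) the set $\bigcap_{\lambda \in \Lambda}FHC(\lambda B_w)$ is non-empty whenever $\Lambda$ is a countable relatively compact subset of $(r_{p,w}^{-1},+\infty)$; (2) the set $\bigcap_{\lambda \in \Lambda}FHC(\lambda B_w)$ is empty whenever $\Lambda$ is unbounded, or $\Lambda$ has at least two elements and $r_w^{-1} \geq \inf(\Lambda)$. In particular, if $r_{p,w}=r_w$ and $\Lambda$ has at least two elements, then the sufficient condition in (1) is also necessary, i.e. $\bigcap_{\lambda \in \Lambda}FHC(\lambda B_w)\neq\emptyset$ if and only if $\Lambda$ is a countable relatively compact subset of $(r_{p,w}^{-1},+\infty)$.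
   Context: $\mathbb{N}=\{0,1,2,\ldots\}$. A weight is a sequence $w=(w_n)_{n\in\mathbb{N}}$ of nonzero real numbers. With $(e_n)_{n\in\mathbb{N}}$ the unit sequence of $\ell^p(\mathbb{N})$, the weighted shift is $B_w(x)=\sum_{n\geq 0}w_{n+1}x_{n+1}e_n$ for $x=\sum_{n\ge 0} x_ne_n$; it is bounded on $\ell^p(\mathbb{N})$ iff $\sup_{n\geq 1}|w_n|<+\infty$. $r_w$ is the spectral radius of $B_w$, $r_w=\lim_{n\to\infty}\Vert B_w^n\Vert^{1/n}$, and $r_{p,w}:=\sup\{|\lambda|:\lambda\in\sigma_p(B_w)\}$, where $\sigma_p(B_w)$ is the set of eigenvalues of $B_w$ on $\ell^p(\mathbb{N})$; one has $r_{p,w}^{-1}=\limsup_{n\to\infty}|w_1\cdots w_n|^{-1/n}$. Convention: $1/0=+\infty$. $FHC(T)$ is the set of frequently hypercyclic vectors of $T$: those $x\in X$ such that for every non-empty open $U\subset X$, $\underline{d}(\{n\in\mathbb{N}:T^n(x)\in U\})>0$, where $\underline{d}(E)=\liminf_{n\to\infty}\frac{\mathrm{card}([0,n]\cap E)}{n+1}$. A subset of an open interval $I$ is relatively compact in $I$ if its closure is a compact subset of $I$. *)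

(* Defs.v *)
From HB Require Import structures.
From mathcomp Require Import all_boot all_order all_algebra.
From mathcomp Require Import complex.
From mathcomp Require Import all_classical all_reals all_analysis.

Set Implicit Arguments.
Unset Strict Implicit.
Unset Printing Implicit Defensive.

Import Order.TTheory GRing.Theory Num.Theory.
Import numFieldNormedType.Exports.

Local Open Scope classical_set_scope.
Local Open Scope ring_scope.

(* l^p(N) may consist of real or of complex sequences; everything below is
   uniform in the choice of the scalar field. *)
Variant scalars := Reals | Complexes.

Definition scalar_field (R : realType) (k : scalars) : numFieldType :=
  match k with Reals => R | Complexes => R[i] end.

Definition of_real (R : realType) (k : scalars) : R -> scalar_field R k :=
  match k with Reals => id | Complexes => real_complex R end.

(* The MathComp norm of a complex number is itself an element of R[i];
   [modulus] is that norm as an element of R. *)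
Definition modulus (R : realType) (k : scalars) : scalar_field R k -> R :=
  match k with Reals => Num.norm | Complexes => fun z => complex.Re `|z| end.

Section modulus_theory.
Context {R : realType} {k : scalars}.
Implicit Types (z t : scalar_field R k) (a b : R).

Lemma of_realD : {morph @of_real R k : a b / a + b}.
Proof. by case: k => //= a b; rewrite rmorphD. Qed.

Lemma of_realM : {morph @of_real R k : a b / a * b}.
Proof. by case: k => //= a b; rewrite rmorphM. Qed.

Lemma of_real0 : of_real k 0 = 0 :> scalar_field R k.
Proof. by case: k. Qed.

Lemma ler_of_real a b : (of_real k a <= of_real k b) = (a <= b).
Proof. by case: k => //=; rewrite lecR. Qed.

Lemma of_real_inj : injective (@of_real R k).
Proof. by case: k => //= a b []. Qed.

Lemma of_real_modulus z : of_real k (modulus z) = `|z|.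
Proof. by case: k z => //= z; rewrite normc_def. Qed.

Lemma modulus_ge0 z : 0 <= modulus z.
Proof. by rewrite -ler_of_real of_real_modulus of_real0. Qed.

Lemma modulusM z t : modulus (z * t) = modulus z * modulus t.
Proof. by apply: of_real_inj; rewrite of_realM !of_real_modulus normrM. Qed.

Lemma modulus0 : modulus (0 : scalar_field R k) = 0.
Proof. by apply: of_real_inj; rewrite of_real_modulus normr0 of_real0. Qed.

Lemma modulus_eq0 z : modulus z = 0 -> z = 0.
Proof.
by move=> z0; apply/normr0_eq0; rewrite -of_real_modulus z0 of_real0.
Qed.

Lemma ler_modulusD z t : modulus (z + t) <= modulus z + modulus t.
Proof. by rewrite -ler_of_real of_realD !of_real_modulus ler_normD. Qed.

End modulus_theory.

Section lpnorm.
Context {R : realType} {k : scalars}.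
Local Notation K := (scalar_field R k).
Implicit Types (p : R) (x y : nat -> K).

(* +oo exactly when x is not p-summable. *)
Definition lpnorm p x : \bar R :=
  ((\sum_(0 <= n <oo) (modulus (x n) `^ p)%:E) `^ p^-1)%E.

Lemma lpnormE p x : 0 < p ->
  lpnorm p x = 'N[counting]_(p%:E)[EFin \o (fun n => modulus (x n))]%E.
Proof.
move=> p0; rewrite Lnorm_counting//; congr (_ `^ _)%E.
apply: eq_eseriesr => n _ /=.
by rewrite ger0_norm ?modulus_ge0.
Qed.

Lemma lpnorm_ge0 p x : (0 <= lpnorm p x)%E.
Proof. exact: poweR_ge0. Qed.

Lemma lpnormD p x y : 1 <= p -> (lpnorm p (x + y)%R <= lpnorm p x + lpnorm p y)%E.
Proof.
move=> p1; have p0 : 0 < p by rewrite (lt_le_trans _ p1).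
apply: (@le_trans _ _ ('N[counting]_(p%:E)[EFin \o
    ((fun n => modulus (x n)) \+ (fun n => modulus (y n)))%R])%E).
  rewrite lpnormE// !Lnorm_counting//.
  apply: gt0_ler_poweR.
  - by rewrite invr_ge0 ltW.
  - by rewrite in_itv/= leey nneseries_ge0// => n _ _; exact: poweR_ge0.
  - by rewrite in_itv/= leey nneseries_ge0// => n _ _; exact: poweR_ge0.
  apply: lee_nneseries => n _ /=; first by rewrite lee_fin powR_ge0.
  rewrite lee_fin ge0_ler_powR ?nnegrE ?normr_ge0 ?(ltW p0)//.
  by rewrite !ger0_norm ?addr_ge0 ?modulus_ge0// ler_modulusD.
rewrite !lpnormE//; exact: minkowski_EFin.
Qed.

Lemma lpnormZ p (a : K) x : 0 < p ->
  lpnorm p (a *: x) = ((modulus a)%:E * lpnorm p x)%E.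
Proof.
move=> p0; rewrite /lpnorm.
under eq_eseriesr do rewrite modulusM powRM ?modulus_ge0// EFinM.
rewrite nneseriesZl//; last by move=> n _; rewrite lee_fin powR_ge0.
rewrite poweRM ?lee_fin ?powR_ge0//; last first.
  by apply: nneseries_ge0 => n _ _; rewrite lee_fin powR_ge0.
by rewrite poweR_EFin -powRrM mulfV ?gt_eqF// powRr1 ?modulus_ge0.
Qed.

Lemma lpnorm0 p : 0 < p -> lpnorm p (0 : nat -> K) = 0%E.
Proof.
move=> p0; rewrite /lpnorm eseries0.
  by rewrite poweR0r// gt_eqF// invr_gt0.
by move=> n _ _; rewrite modulus0 powR0// gt_eqF.
Qed.

Lemma lpnorm_eq0 p x : 0 < p -> lpnorm p x = 0%E -> x = 0.
Proof.
move=> p0 nx0.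
have pge0 n : (0 <= (modulus (x n) `^ p)%:E)%E by rewrite lee_fin powR_ge0.
have s0 : (\sum_(0 <= n <oo) (modulus (x n) `^ p)%:E = 0)%E.
  by apply: poweR_eq0_eq0 nx0; exact: nneseries_ge0.
apply/funext => n; apply: modulus_eq0; apply: (@powR_eq0_eq0 _ _ p).
apply/eqP; rewrite eq_le powR_ge0 andbT -lee_fin -[leRHS]s0.
apply: (@le_trans _ _ (\sum_(0 <= i < n.+1) (modulus (x i) `^ p)%:E)%E).
  rewrite big_nat_recr//= leeDr// sume_ge0// => i _; exact: pge0.
exact: nneseries_lim_ge.
Qed.

End lpnorm.

Section lp_space.
Context {R : realType} (k : scalars) {p : R}.
Local Notation K := (scalar_field R k).

Definition lp_pred (p1 : 1 <= p) : {pred nat -> K} :=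
  fun x => (lpnorm p x < +oo)%E.

Context (p1 : 1 <= p).
Let p0 : 0 < p. Proof. exact: lt_le_trans p1. Qed.

Record lp := Lp { lp_val :> nat -> K ; lp_valP : lp_val \in lp_pred p1 }.

HB.instance Definition _ := [isSub for lp_val].
HB.instance Definition _ := [Choice of lp by <:].

Lemma lp_submod_closed : submod_closed (lp_pred p1).
Proof.
split=> [|a x y xp yp]; first by rewrite unfold_in /lp_pred lpnorm0.
rewrite unfold_in /lp_pred (le_lt_trans (lpnormD _ _ p1))//.
by rewrite lpnormZ// lte_add_pinfty// lte_mul_pinfty// lee_fin modulus_ge0.
Qed.

HB.instance Definition _ := GRing.isSubmodClosed.Build _ _ (lp_pred p1)
  lp_submod_closed.
HB.instance Definition _ := [SubChoice_isSubLmodule of lp by <:].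

Definition lp_norm (x : lp) : K := of_real k (fine (lpnorm p x)).

Lemma lpnorm_fin (x : lp) : lpnorm p x \is a fin_num.
Proof. by rewrite ge0_fin_numE ?lpnorm_ge0//; exact: lp_valP. Qed.

Lemma ler_lp_normD (x y : lp) : lp_norm (x + y) <= lp_norm x + lp_norm y.
Proof.
rewrite -of_realD ler_of_real -fineD ?lpnorm_fin// fine_le//.
- by rewrite lpnorm_fin.
- by rewrite fin_numD !lpnorm_fin.
- exact: lpnormD.
Qed.

Lemma lp_normZ (a : K) (x : lp) : lp_norm (a *: x) = `|a| * lp_norm x.
Proof.
by rewrite -of_real_modulus -of_realM /lp_norm lpnormZ// fineM// lpnorm_fin.
Qed.

Lemma lp_norm_eq0 (x : lp) : lp_norm x = 0 -> x = 0.
Proof.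
rewrite -(of_real0 (k := k)) => /of_real_inj x0.
by apply/val_inj/(lpnorm_eq0 p0); rewrite -(fineK (lpnorm_fin x)) x0.
Qed.

HB.instance Definition _ := Lmodule_isNormed.Build K lp
  ler_lp_normD lp_normZ lp_norm_eq0.

End lp_space.

(* [sup] and [limn] are total. For a bounded weighted shift the two sets
   below are non-empty (0 is an eigenvalue) and bounded, and the limit exists
   by submultiplicativity, so no default value is used. *)
Section operators.
Context {R : realType} {k : scalars}.
Local Notation K := (scalar_field R k).

Definition opnorm (X : normedModType K) (T : X -> X) : R :=
  sup [set modulus `|T x| | x in [set x : X | `|x| <= 1]].

Definition spectral_radius (X : normedModType K) (T : X -> X) : R :=
  limn (fun n : nat => opnorm (iter n T) `^ n%:R^-1).

Definition point_spectrum (X : lmodType K) (T : X -> X) : set K :=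
  [set mu | exists2 x : X, x != 0 & T x = mu *: x].

Definition point_spectral_radius (X : lmodType K) (T : X -> X) : R :=
  sup [set modulus mu | mu in point_spectrum T].

End operators.

Definition lower_density (R : realType) (E : set nat) : \bar R :=
  limn_einf (fun n => ((\sum_(i < n.+1) (val i \in E))%:R / n.+1%:R)%:E).

Definition FHC (R : realType) (X : topologicalType) (T : X -> X) : set X :=
  [set x | forall U : set X, open U -> U !=set0 ->
     (0 < lower_density R [set n | U (iter n T x)])%E].

Definition relatively_compact (T : topologicalType) (I A : set T) :=
  compact (closure A) /\ closure A `<=` I.

Section weighted_shift.
Context {R : realType} (k : scalars) {p : R} (p1 : 1 <= p) (w : nat -> R).
Local Notation K := (scalar_field R k).

Definition shift_seq (x : nat -> K) : nat -> K :=
  fun n => of_real k (w n.+1) * x n.+1.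

(* B_w maps l^p(N) into itself and is bounded there: the right-hand side is
   finite for x in l^p(N). *)
Definition bounded_shift := exists M : R, forall x : lp k p1,
  (lpnorm p (shift_seq x) <= M%:E * lpnorm p x)%E.

Lemma shift_seq_lp (Bw : bounded_shift) (x : lp k p1) :
  shift_seq x \in lp_pred p1.
Proof.
have [M MB] := Bw; rewrite unfold_in /lp_pred (le_lt_trans (MB x))//.
by rewrite ltey_eq fin_numM ?lpnorm_fin.
Qed.

Definition weighted_shift (Bw : bounded_shift) (x : lp k p1) : lp k p1 :=
  Lp (shift_seq_lp Bw x).

End weighted_shift.

(* Main.v *)
Require Import Defs.
From mathcomp Require Import all_boot all_order all_algebra.
From mathcomp Require Import complex.
From mathcomp Require Import all_classical all_reals all_analysis.
From mathcomp Require Import ring lra zify.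

(** Write W n = w_1 ... w_n. In the coordinates z_n = W n x_n the operator l B acts
    as z |-> (l z_(n+1))_n, and the weights only appear in the norm, which is the
    l^p norm of (z_n / W n)_n.

    Existence. Let a = inf Lambda and b = sup Lambda. As 1 / r_p < a, there is an
    eigenvalue of modulus 1/a0 with a0 < a, and its eigenvector shows that
    1 / |W n| <= C a0^n ([point_spectral_radius_decay]). A common frequently
    hypercyclic vector is then written down explicitly ([block_seq]). Enumerate all
    triples (l, v, e) of a parameter, a finite rational word and an accuracy. The
    i-th triple receives infinitely many of the blocks [q^k, 2 q^k], at the k of
    2-adic valuation i, so that its times have positive lower density
    ([block_times_density]); at each time n of these blocks, spaced by N i, the word
    l^-n v is written into z. After n steps with the parameter l the word v stands
    in front. The words of the same block that follow are damped by (a0 / l)^(N i).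
    Those of later blocks carry the scaling of another parameter l', which may cost
    a factor (l / l')^n <= (b / a)^n; but they start at some m >= (q / 2) n, and the
    damping (a0 / a)^(m-n) wins when q is large ([block_seq_visit]).

    Obstructions. A set of positive lower density meets the intervals [n, Q n]
    for some fixed Q and all large n ([lower_density_gt0_gap]). If n is a time when the m-orbit of x is
    near 0 and N >= n a time when the l-orbit is near the unit vector e_0, then
    m^n <= 2 |B^(N-n)| l^N ([visits_growth]), which separates n from N by a large
    ratio in two cases: when l is fixed and m is large, so that the visits of the
    l-orbit have too large gaps ([unbounded_no_common_FHC]); and when m is fixed and
    l tends to inf Lambda <= 1 / r, because |B^j| l^j then grows slower than any
    given exponential, so that the visits of the m-orbit have too large gaps
    ([inf_le_no_common_FHC]).

    Necessity of countability. At a visit n of the l-orbit to e_0, |z_n| is about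
    l^-n. So distinct parameters have almost disjoint visit times, and only
    countably many almost disjoint sets can have positive lower density
    ([common_FHC_countable]). *)

Set Implicit Arguments.
Unset Strict Implicit.
Unset Printing Implicit Defensive.

Import Order.TTheory GRing.Theory Num.Theory.
Import numFieldNormedType.Exports.

Local Open Scope classical_set_scope.
Local Open Scope ring_scope.

(** * Geometric sequences *)

Section geometric_bounds.
Context {R : realType}.

Lemma geometric_eventually_le (c s e : R) : 0 <= s < 1 -> 0 < e ->
  exists N, forall n, (N <= n)%N -> c * s ^+ n <= e.
Proof.
move=> /andP[s0 s1] e0.
have /cvgrPdist_le/(_ e e0)[N _ HN] : c * s ^+ n @[n --> \oo] --> (0 : R).
  by apply: cvg_geometric; rewrite ger0_norm.
exists N => n /HN /=; rewrite sub0r normrN; apply: le_trans; exact: ler_norm.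
Qed.

Lemma geometric_eventually_gt (c b : R) : 1 < b ->
  exists N, forall n, (N <= n)%N -> c < b ^+ n.
Proof.
move=> b1; have b0 : 0 < b by exact: lt_trans b1.
have bV : 0 <= b^-1 < 1 by rewrite invr_ge0 ltW//= invf_lt1.
have [N HN] := geometric_eventually_le (`|c| + 1) bV ltr01.
exists N => n /HN; rewrite exprVn ler_pdivrMr ?exprn_gt0// mul1r.
by apply: lt_le_trans; rewrite (le_lt_trans (ler_norm c))// ltrDl.
Qed.

End geometric_bounds.

(** * Lower density *)

Definition counting_fun (E : set nat) (n : nat) : nat :=
  (\sum_(i < n.+1) (val i \in E))%N.

Section lower_density.
Context {R : realType}.
Implicit Types E F : set nat.

(** An integer form of positivity: the density is eventually at least 1/D. *)
Lemma lower_density_gt0P E : (0 < lower_density R E)%E <->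
  exists D N, forall n, (N <= n)%N -> (n < D * counting_fun E n)%N.
Proof.
rewrite /lower_density limn_einf_lim; set u := (fun n : nat => _ : \bar R).
have uE n : u n = ((counting_fun E n)%:R / n.+1%:R)%:E by [].
rewrite (cvg_lim (@ereal_hausdorff R) (@cvg_einfs_sup R u)); split.
  move=> /ereal_sup_gt[_ [N _ <-]] /= uN.
  pose m := ereal_inf (sdrop u N).
  have [e e0 em] : exists2 e : R, 0 < e & (e%:E <= m)%E.
    have mp : (0 < m)%E by []. case: m mp => [r||] //; first by rewrite lte_fin => r0; exists r.
    by exists 1; rewrite ?leey.
  have [D De] : exists D : nat, e^-1 <= D%:R.
    by exists (Num.Def.archi_bound e^-1); rewrite ltW// archi_boundP// invr_ge0 ltW.
  exists D, N => n Nn.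
  have : (e%:E <= u n)%E by apply: (le_trans em); apply: ereal_inf_lbound; exists n.
  rewrite uE lee_fin ler_pdivlMr ?ltr0n// => H.
  rewrite -(ltr_nat R) natrM.
  apply: (@lt_le_trans _ _ n.+1%:R); first by rewrite ltr_nat.
  rewrite -(mulKf (lt0r_neq0 e0) n.+1%:R) ler_pM ?mulr_ge0 ?invr_ge0 ?(ltW e0)//.
move=> [D [N H]].
have D0 : (0 < D)%N by have := H N (leqnn N); case: (D) => //; rewrite mul0n.
have e0 : 0 < (D%:R : R)^-1 by rewrite invr_gt0 ltr0n.
apply: (@lt_le_trans _ _ ((D%:R : R)^-1%:E)); first by rewrite lte_fin.
apply: (@le_trans _ _ (einfs u N)); last by apply: ereal_sup_ubound; exists N.
apply: le_ereal_inf_tmp => _ /= [n Nn <-]; rewrite uE lee_fin.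
rewrite ler_pdivlMr ?ltr0n// mulrC ler_pdivrMr ?ltr0n//.
by rewrite -natrM ler_nat mulnC H.
Qed.

Lemma counting_fun_le E F n : E `<=` F -> (counting_fun E n <= counting_fun F n)%N.
Proof.
move=> EF; apply: leq_sum => i _.
by case: (boolP (val i \in E)) => // /set_mem/EF/mem_set ->.
Qed.

Lemma lower_density_gt0_sub E F : E `<=` F ->
  (0 < lower_density R E)%E -> (0 < lower_density R F)%E.
Proof.
move=> EF /lower_density_gt0P[D [N H]]; apply/lower_density_gt0P.
exists D, N => n /H /leq_trans; apply; rewrite leq_mul2l.
by rewrite counting_fun_le// orbT.
Qed.

Lemma counting_fun_bounded E m n : (forall i, (i <= m)%N -> E i -> (i < n)%N) ->
  (counting_fun E m <= n)%N.
Proof.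
move=> En; have card_lt j : (\sum_(i < j) (i < n) = minn j n)%N.
  elim: j => [|j IH]; first by rewrite big_ord0 min0n.
  by rewrite big_ord_recr/= IH; case: ltnP; lia.
apply: leq_trans (geq_minr m.+1 n); rewrite -card_lt; apply: leq_sum => i _.
by case: (boolP (val i \in E)) => // /set_mem/En ->//; rewrite -ltnS ltn_ord.
Qed.

(** A set of positive lower density cannot have gaps [n, Q n[ with n and Q both
    large: such a gap would bring the density at Q n below 1/Q. *)
Lemma lower_density_gt0_gap E : (0 < lower_density R E)%E ->
  exists Q N, (0 < Q)%N /\ forall n, (N <= n)%N ->
    exists2 e, E e & (n <= e <= Q * n)%N.
Proof.
move=> /lower_density_gt0P[D [N H]].
have D0 : (0 < D)%N by have := H N (leqnn N); case: (D) => //; rewrite mul0n.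
exists D, N.+1; split => // n Nn; apply: contrapT => nex.
have := H (D * n)%N; rewrite ltn_pmul2l// => /(_ _)/wrap[].
  by rewrite (leq_trans (ltnW Nn))// leq_pmull.
apply/negP; rewrite -leqNgt; apply: counting_fun_bounded => i iDn Ei.
by rewrite ltnNge; apply/negP => ni; apply: nex; exists i; rewrite ?ni.
Qed.

End lower_density.

(** * Norms on l^p *)

Section modulus.
Context {R : realType} {k : scalars}.
Local Notation K := (scalar_field R k).
Implicit Types (z t : K) (a : R).

Lemma of_real1 : of_real k 1 = 1 :> K.
Proof. by case: k. Qed.

Lemma of_realV a : of_real k a^-1 = (of_real k a)^-1 :> K.
Proof. by case: k => //=; rewrite fmorphV. Qed.

Lemma norm_of_real a : `|of_real k a : K| = of_real k `|a|.
Proof. by case: k => //=; rewrite normc_def/= expr0n addr0 sqrtr_sqr. Qed.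

Lemma modulus_of_real a : modulus (of_real k a) = `|a|.
Proof. by apply: (@of_real_inj _ k); rewrite of_real_modulus norm_of_real. Qed.

Lemma modulus_norm z : modulus `|z| = modulus z.
Proof. by rewrite -of_real_modulus modulus_of_real ger0_norm// modulus_ge0. Qed.

Lemma modulusN z : modulus (- z) = modulus z.
Proof. by rewrite -modulus_norm normrN modulus_norm. Qed.

Lemma modulus1 : modulus (1 : K) = 1.
Proof. by rewrite -of_real1 modulus_of_real normr1. Qed.

Lemma modulus_gt0 z : (0 < modulus z) = (z != 0).
Proof.
rewrite lt_def modulus_ge0 andbT; congr (~~ _); apply/eqP/eqP => [/modulus_eq0//|->].
exact: modulus0.
Qed.

Lemma modulusX z n : modulus (z ^+ n) = modulus z ^+ n.
Proof. by elim: n => [|n IH]; rewrite ?expr0 ?modulus1// !exprS modulusM IH. Qed.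

Lemma modulusV z : modulus z^-1 = (modulus z)^-1.
Proof.
have [->|z0] := eqVneq z 0; first by rewrite invr0 modulus0 invr0.
by apply: (mulIf (lt0r_neq0 (etrans (modulus_gt0 z) z0)));
  rewrite -modulusM !mulVf ?modulus1// gt_eqF// modulus_gt0.
Qed.

Lemma ler_modulusB z t : modulus z - modulus t <= modulus (z - t).
Proof. by rewrite lerBlDr (le_trans _ (ler_modulusD _ _))// subrK. Qed.

Lemma gt0_of_real z : 0 < z -> of_real k (modulus z) = z.
Proof. by move=> z0; rewrite of_real_modulus ger0_norm// ltW. Qed.

End modulus.

Section lp_theory.
Context {R : realType} {k : scalars} {p : R} {p1 : 1 <= p}.
Local Notation K := (scalar_field R k).
Local Notation lp := (lp k p1).
Implicit Types (x y : lp) (u v : nat -> K).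

Let p0 : 0 < p. Proof. exact: lt_le_trans p1. Qed.

(** The norm of [lp], as a real number rather than as a scalar. *)
Definition nrm x : R := modulus `|x|.

Lemma nrmE x : nrm x = fine (lpnorm p x).
Proof.
rewrite /nrm -[`|x|]/(of_real k (fine (lpnorm p x))) modulus_of_real.
by rewrite ger0_norm// fine_ge0// lpnorm_ge0.
Qed.

Lemma lpnorm_nrm x : lpnorm p x = (nrm x)%:E.
Proof. by rewrite nrmE fineK// lpnorm_fin. Qed.

Lemma of_real_nrm x : `|x| = of_real k (nrm x).
Proof. by rewrite nrmE. Qed.

Lemma nrm_ge0 x : 0 <= nrm x. Proof. exact: modulus_ge0. Qed.

Lemma nrmZ (a : K) x : nrm (a *: x) = modulus a * nrm x.
Proof. by rewrite /nrm normrZ modulusM modulus_norm. Qed.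

Lemma nrmN x : nrm (- x) = nrm x. Proof. by rewrite /nrm normrN. Qed.

Lemma nrmD x y : nrm (x + y) <= nrm x + nrm y.
Proof.
rewrite -(ler_of_real (k := k)) of_realD -!of_real_nrm; exact: ler_normD.
Qed.

Lemma modulus_le_lpnorm u n : ((modulus (u n))%:E <= lpnorm p u)%E.
Proof.
have ge0 i : (0 <= (modulus (u i) `^ p)%:E)%E by rewrite lee_fin powR_ge0.
have le : ((modulus (u n) `^ p)%:E <= \sum_(0 <= i <oo) (modulus (u i) `^ p)%:E)%E.
  apply: (@le_trans _ _ (\sum_(0 <= i < n.+1) (modulus (u i) `^ p)%:E)%E).
    by rewrite big_nat_recr//= leeDr// sume_ge0.
  exact: nneseries_lim_ge.
rewrite /lpnorm -[X in (X <= _)%E]poweRe1 ?lee_fin ?modulus_ge0//.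
rewrite -(mulfV (lt0r_neq0 p0)) poweRrM poweR_EFin.
apply: gt0_ler_poweR => //; first by rewrite invr_ge0 ltW.
- by rewrite in_itv/= leey andbT ge0.
- by rewrite in_itv/= leey andbT nneseries_ge0.
Qed.

Lemma modulus_le_nrm x n : modulus (x n) <= nrm x.
Proof. by rewrite -lee_fin -lpnorm_nrm modulus_le_lpnorm. Qed.

(** The bound does not depend on p: this is what makes all later estimates
    uniform in the exponent. *)
Lemma lpnorm_geometric u (c s : R) : 0 <= c -> 0 < s < 1 ->
  (forall n, modulus (u n) <= c * s ^+ n) -> (lpnorm p u <= (c / (1 - s))%:E)%E.
Proof.
move=> c0 /andP[s0 s1] us.
have d0 : 0 < 1 - s by rewrite subr_gt0.
have d1 : 1 <= (1 - s)^-1 by rewrite invf_ge1// lerBlDr lerDl ltW.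
have cp0 : 0 <= c `^ p by exact: powR_ge0.
have sum_le : (\sum_(0 <= n <oo) (modulus (u n) `^ p)%:E <= (c `^ p / (1 - s))%:E)%E.
  apply: lime_le; first by apply: is_cvg_nneseries => n _ _; rewrite lee_fin powR_ge0.
  apply: nearW => n; rewrite sumEFin lee_fin.
  apply: (le_trans _ (geometric_le_lim n cp0 s0 _)); last by rewrite ger0_norm ?(ltW s0).
  apply: ler_sum => i _ /=.
  apply: (@le_trans _ _ ((c * s ^+ i) `^ p)).
    by rewrite ge0_ler_powR ?nnegrE ?modulus_ge0 ?mulr_ge0 ?exprn_ge0 ?(ltW s0) ?(ltW p0).
  rewrite powRM ?exprn_ge0 ?(ltW s0)// ler_wpM2l//.
  by rewrite ge1r_powR// exprn_gt0//= exprn_ile1 ?ltW.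
apply: (@le_trans _ _ ((c `^ p / (1 - s))%:E `^ p^-1)%E).
  apply: gt0_ler_poweR => //; first by rewrite invr_ge0 ltW.
  - by rewrite in_itv/= leey nneseries_ge0// => *; rewrite lee_fin powR_ge0.
  - by rewrite in_itv/= leey andbT lee_fin mulr_ge0 ?powR_ge0// invr_ge0 ltW.
rewrite poweR_EFin lee_fin powRM ?powR_ge0 ?invr_ge0 ?(ltW d0)//.
rewrite -powRrM mulfV ?lt0r_neq0// powRr1// ler_wpM2l//.
by rewrite ler1_powR// invf_le1.
Qed.

Lemma nrm_geometric x (c s : R) : 0 <= c -> 0 < s < 1 ->
  (forall n, modulus (x n) <= c * s ^+ n) -> nrm x <= c / (1 - s).
Proof. by move=> c0 s01 xs; rewrite -lee_fin -lpnorm_nrm lpnorm_geometric. Qed.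

Lemma geometric_in_lp u (c s : R) : 0 <= c -> 0 < s < 1 ->
  (forall n, modulus (u n) <= c * s ^+ n) -> u \in lp_pred p1.
Proof.
move=> c0 s01 us; rewrite unfold_in /lp_pred.
by rewrite (le_lt_trans (lpnorm_geometric c0 s01 us))// ltry.
Qed.

(** The balls of [lp] have their radius in the scalar field; a positive
    complex number is real, so that real radii suffice. *)
Lemma open_nrm_ball (U : set lp) x : open U -> U x ->
  exists2 e : R, 0 < e & forall y, nrm (x - y) < e -> U y.
Proof.
rewrite openE => /[apply] /nbhs_ballP[e /= e0 eU].
exists (modulus e) => [|y xy]; first by rewrite modulus_gt0 gt_eqF.
apply: eU; rewrite -ball_normE /= -(gt0_of_real e0) of_real_nrm.
by rewrite lt_neqAle ler_of_real (ltW xy) andbT; apply/eqP => /of_real_inj/eqP; rewrite lt_eqF.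
Qed.

Lemma nrm_ball_open x (e : R) : open [set y | nrm (x - y) < e].
Proof.
rewrite (_ : mkset _ = ball x (of_real k e)); first exact: ball_open.
apply/seteqP; split => y; rewrite -ball_normE /= of_real_nrm => xy.
  by rewrite lt_neqAle ler_of_real (ltW xy) andbT; apply/eqP => /of_real_inj/eqP; rewrite lt_eqF.
by move: xy; rewrite lt_neqAle ler_of_real lt_neqAle => /andP[/eqP ne ->]; rewrite andbT;
  apply/eqP => e'; apply: ne; rewrite e'.
Qed.

Lemma FHCP (T : lp -> lp) x : FHC R T x <->
  forall y (e : R), 0 < e ->
    (0 < lower_density R [set n | nrm (y - iter n T x) < e]%R)%E.
Proof.
split=> [Fx y e e0|Fx U oU [y Uy]].
  apply: (Fx [set z | nrm (y - z) < e]); first exact: nrm_ball_open.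
  by exists y; rewrite /= subrr -(scale0r (0 : lp)) nrmZ modulus0 mul0r.
have [e e0 eU] := open_nrm_ball oU Uy.
by apply: lower_density_gt0_sub (Fx y e e0) => n; exact: eU.
Qed.

End lp_theory.

(** * The spectral radius *)

Section submultiplicative.
Context {R : realType}.
Variable a : nat -> R.
Hypothesis a_ge0 : forall n, 0 <= a n.
Hypothesis aM : forall m n, a (m + n)%N <= a m * a n.

Let b n := a n `^ n%:R^-1.

Let aE n : (0 < n)%N -> a n = b n ^+ n.
Proof.
move=> n0; rewrite -powR_mulrn ?powR_ge0// -powRrM mulVf ?powRr1//.
by rewrite pnatr_eq0 -lt0n.
Qed.

Let L := inf [set b n | n in [set n | (0 < n)%N]].

Let hasL : has_inf [set b n | n in [set n | (0 < n)%N]].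
Proof.
split; first by exists (b 1); exists 1%N.
by exists 0 => _ [n _ <-]; exact: powR_ge0.
Qed.

Let L_ge0 : 0 <= L.
Proof.
by apply: lb_le_inf => [|_ [n _ <-]]; [exact: hasL.1|exact: powR_ge0].
Qed.

(* Write n = q m + s with s < m: then a n <= (a m)^q a s, and a m <= rho^m. *)
Let growth rho : L < rho -> exists2 C, 0 < C & forall n, a n <= C * rho ^+ n.
Proof.
move=> Lrho; have rho0 : 0 < rho by exact: le_lt_trans Lrho.
have [_ [m /= m0 <-] bm] : exists2 e, [set b n | n in [set n | (0 < n)%N]] e & e < rho.
  have [|e Se] := @inf_adherent R _ (rho - L) _ hasL; first by rewrite subr_gt0.
  by rewrite -/L addrC subrK; exists e.
have am : a m <= rho ^+ m by rewrite aE// lerXn2r ?nnegrE ?powR_ge0 ?(ltW rho0) ?(ltW bm).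
have aq q s : a (q * m + s)%N <= rho ^+ (q * m) * a s.
  elim: q => [|q IH]; first by rewrite mul0n expr0 mul1r add0n.
  rewrite mulSn -addnA (le_trans (aM _ _))// exprD -mulrA.
  by rewrite ler_pM.
pose C := \sum_(s < m) a s / rho ^+ s + 1.
have t0 s : 0 <= a s / rho ^+ s by rewrite mulr_ge0 ?invr_ge0 ?exprn_ge0 ?(ltW rho0).
have C0 : 0 < C by rewrite ltr_wpDl// sumr_ge0.
exists C => // n; have nE := divn_eq n m.
rewrite {1}nE (le_trans (aq _ _))// [in leRHS]nE exprD mulrCA ler_pM2l ?exprn_gt0//.
rewrite -ler_pdivrMr ?exprn_gt0// /C.
by rewrite (bigD1 (Ordinal (ltn_pmod n m0)))//= -addrA lerDl addr_ge0// sumr_ge0.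
Qed.

Let cvg_root : b n @[n --> \oo] --> L.
Proof.
apply/cvgrPdist_le => e e0.
have [|C C0 HC] := @growth (L + e / 2); first by rewrite ltrDl divr_gt0.
have rho0 : 0 < L + e / 2 by rewrite ltr_wpDl// divr_gt0.
have Le0 : 0 < L + e by rewrite ltr_wpDl.
have [N HN] : exists N, forall n, (N <= n)%N -> C < ((L + e) / (L + e / 2)) ^+ n.
  apply: geometric_eventually_gt; rewrite ltr_pdivlMr// mul1r ltrD2l.
  by rewrite ltr_pdivrMr// ltr_pMr// ltr1n.
near=> n.
have n0 : (0 < n)%N by near: n; exact: nbhs_infty_gt.
have Lb : L <= b n by apply: ge_inf; [exact: hasL.2|exists n].
rewrite distrC ger0_norm ?subr_ge0// lerBlDl.
have : b n ^+ n <= (L + e) ^+ n.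
  rewrite -aE// (le_trans (HC n))//.
  rewrite -ler_pdivlMr ?exprn_gt0// -expr_div_n ltW// HN//.
  by near: n; exact: nbhs_infty_ge.
by rewrite ler_pXn2r ?nnegrE ?powR_ge0 ?(ltW Le0).
Unshelve. all: by end_near. Qed.

Lemma root_lim_ge0 : 0 <= limn (fun n => a n `^ n%:R^-1).
Proof. by rewrite (cvg_lim (@Rhausdorff R) cvg_root). Qed.

(** Fekete's lemma makes the roots converge to their infimum, so that a single
    root below rho controls the growth of the whole sequence. *)
Lemma root_lim_growth rho : limn (fun n => a n `^ n%:R^-1) < rho ->
  exists2 C, 0 < C & forall n, a n <= C * rho ^+ n.
Proof. by rewrite (cvg_lim (@Rhausdorff R) cvg_root); exact: growth. Qed.

End submultiplicative.

Section opnorm_theory.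
Context {R : realType} {k : scalars} {p : R} {p1 : 1 <= p}.
Local Notation K := (scalar_field R k).
Local Notation lp := (lp k p1).
Implicit Types (T : lp -> lp) (x : lp) (c : R).

Let le1E x : (`|x| <= 1) = (nrm x <= 1).
Proof. by rewrite of_real_nrm -(of_real1 (k := k)) ler_of_real. Qed.

Lemma opnorm_le T c : 0 <= c -> (forall x, nrm (T x) <= c * nrm x) -> opnorm T <= c.
Proof.
move=> c0 Tc; apply: ge_sup; first by exists (modulus `|T 0|); exists 0; rewrite //= normr0.
move=> _ [x /= x1 <-]; rewrite -/(nrm (T x)) (le_trans (Tc x))//.
by rewrite ler_piMr// -le1E.
Qed.

(** The bound c is what makes the supremum defining [opnorm] a genuine one. *)
Lemma le_opnorm T c x : 0 <= c -> (forall x, nrm (T x) <= c * nrm x) ->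
  (forall (a : K) x, T (a *: x) = a *: T x) -> nrm (T x) <= opnorm T * nrm x.
Proof.
move=> c0 Tc TZ.
have [x0|x0] := eqVneq (nrm x) 0; first by rewrite x0 mulr0 (le_trans (Tc x))// x0 mulr0.
have xp : 0 < nrm x by rewrite lt_def x0 nrm_ge0.
rewrite -ler_pdivrMr// mulrC.
have -> : (nrm x)^-1 * nrm (T x) = nrm (T (of_real k (nrm x)^-1 *: x)).
  by rewrite TZ nrmZ modulus_of_real ger0_norm ?invr_ge0 ?nrm_ge0.
apply: ub_le_sup.
  exists c => _ [y /= y1 <-]; rewrite -/(nrm (T y)) (le_trans (Tc y))//.
  by rewrite ler_piMr// -le1E.
exists (of_real k (nrm x)^-1 *: x) => //=.
by rewrite le1E nrmZ modulus_of_real ger0_norm ?invr_ge0 ?nrm_ge0// mulVf.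
Qed.

Lemma opnorm_ge0 T c : 0 <= c -> (forall x, nrm (T x) <= c * nrm x) -> 0 <= opnorm T.
Proof.
move=> c0 Tc; apply: (le_trans (nrm_ge0 (T 0))); apply: ub_le_sup.
  exists c => _ [y /= y1 <-]; rewrite -/(nrm (T y)) (le_trans (Tc y))//.
  by rewrite ler_piMr// -le1E.
by exists 0; rewrite //= normr0.
Qed.

Lemma spectral_radius_growth T c : 0 <= c ->
  (forall x, nrm (T x) <= c * nrm x) -> (forall (a : K) x, T (a *: x) = a *: T x) ->
  0 <= spectral_radius T /\ forall rho, spectral_radius T < rho ->
    exists2 C, 0 < C & forall n x, nrm (iter n T x) <= C * rho ^+ n * nrm x.
Proof.
move=> c0 Tc TZ.
have Tnc n x : nrm (iter n T x) <= c ^+ n * nrm x.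
  elim: n => [|n IH]; first by rewrite expr0 mul1r.
  by rewrite iterS exprS -mulrA (le_trans (Tc _))// ler_wpM2l.
have TnZ n (a : K) x : iter n T (a *: x) = a *: iter n T x.
  by elim: n => //= n ->; exact: TZ.
pose a n := opnorm (iter n T).
have a0 n : 0 <= a n by apply: opnorm_ge0 (Tnc n); rewrite exprn_ge0.
have le_a n x : nrm (iter n T x) <= a n * nrm x.
  by apply: le_opnorm (Tnc n) (TnZ n); rewrite exprn_ge0.
have aM m n : a (m + n)%N <= a m * a n.
  apply: opnorm_le => [|x]; first by rewrite mulr_ge0.
  by rewrite iterD (le_trans (le_a _ _))// -mulrA ler_wpM2l.
split; first exact: root_lim_ge0 a0 aM.
move=> rho /(root_lim_growth a0 aM)[C C0 HC]; exists C => // n x.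
by rewrite (le_trans (le_a n x))// ler_wpM2r ?nrm_ge0.
Qed.

End opnorm_theory.

(** * Weighted shifts *)

Section weighted_shift_theory.
Context {R : realType} {k : scalars} {p : R} {p1 : 1 <= p}.
Local Notation K := (scalar_field R k).
Local Notation lp := (lp k p1).
Variable w : nat -> R.
Hypothesis w_neq0 : forall n, w n != 0.
Hypothesis Bw : bounded_shift k p1 w.
Local Notation B := (weighted_shift Bw).
Implicit Types (x : lp) (l : R).

Definition weight_prod n : R := \prod_(i < n) w i.+1.
Local Notation W := weight_prod.

Lemma weight_prodS n : W n.+1 = W n * w n.+1.
Proof. by rewrite /weight_prod big_ord_recr. Qed.

Lemma weight_prod_neq0 n : W n != 0.
Proof. by rewrite /weight_prod; apply/prodf_neq0. Qed.

Lemma scaled_shiftE l x n :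
  (of_real k l *: B x : lp) n = of_real k l * (of_real k (w n.+1) * x n.+1).
Proof. by []. Qed.

(** In the coordinates z_n = W n x_n the shift is unweighted: the weights enter
    only through the factor 1 / W s of the norm. *)
Lemma iter_scaled_shift l n x s : iter n (fun x => of_real k l *: B x) x s =
  of_real k (l ^+ n * (W (n + s) / W s)) * x (n + s)%N.
Proof.
elim: n s => [|n IH] s.
  by rewrite add0n divff ?weight_prod_neq0// expr0 mulr1 of_real1 mul1r.
rewrite iterS scaled_shiftE IH addnS addSn !mulrA -!of_realM; congr (of_real k _ * _).
rewrite exprS [W s.+1]weight_prodS; field.
by rewrite weight_prod_neq0 w_neq0.
Qed.

Lemma shift_bounded : exists2 c : R, 0 <= c & forall x, nrm (B x) <= c * nrm x.
Proof.
have [M HM] := Bw; exists `|M| => // x.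
have := HM x; rewrite lpnorm_nrm -[shift_seq w x]/(lp_val (B x)) lpnorm_nrm -EFinM lee_fin.
by move=> /le_trans; apply; rewrite ler_wpM2r ?nrm_ge0 ?ler_norm.
Qed.

Lemma shiftZ (a : K) x : B (a *: x) = a *: B x.
Proof.
apply/val_inj/funext => n.
by rewrite -[LHS]/(of_real k (w n.+1) * (a * x n.+1)) mulrCA.
Qed.

Lemma iter_scaled_shiftZ l n x :
  iter n (fun x => of_real k l *: B x) x = of_real k l ^+ n *: iter n B x.
Proof.
elim: n => [|n IH]; first by rewrite expr0 scale1r.
by rewrite iterS IH shiftZ scalerA -exprS.
Qed.

(** The n-th coordinate of an eigenvector for mu is x_0 mu^n / W n, and the
    coordinates of an l^p sequence are bounded. *)
Lemma point_spectrum_decay (mu : K) : mu != 0 -> point_spectrum B mu ->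
  exists2 C, 0 <= C & forall n, `|W n|^-1 <= C * (modulus mu)^-1 ^+ n.
Proof.
move=> mu0 [x x0 xmu].
have xS n : of_real k (w n.+1) * x n.+1 = mu * x n by have := congr1 (fun y : lp => y n) xmu.
have xE n : of_real k (W n) * x n = mu ^+ n * x 0%N.
  elim: n => [|n IH]; first by rewrite /weight_prod big_ord0 of_real1 expr0.
  by rewrite weight_prodS of_realM -mulrA xS mulrCA IH mulrA -exprS.
have W0 n : of_real k (W n) != 0 :> K by rewrite -modulus_gt0 modulus_of_real normr_gt0 weight_prod_neq0.
have x00 : x 0%N != 0.
  apply: contra_neq x0 => x0; apply/val_inj/funext => n /=.
  by apply: (mulfI (W0 n)); rewrite xE x0 !mulr0.
exists (nrm x / modulus (x 0%N)) => [|n]; first by rewrite mulr_ge0 ?nrm_ge0 ?invr_ge0 ?modulus_ge0.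
have m0 : 0 < modulus mu by rewrite modulus_gt0.
have xn0 : 0 < modulus (x 0%N) by rewrite modulus_gt0.
have Wn : 0 < `|W n| by rewrite normr_gt0 weight_prod_neq0.
have := congr1 (@modulus R k) (xE n); rewrite !modulusM modulus_of_real modulusX => E.
rewrite exprVn -mulrA -invfM ler_pdivlMr ?mulr_gt0 ?exprn_gt0//.
by rewrite ler_pdivrMl// mulrC -E ler_pM2l// modulus_le_nrm.
Qed.

(** Some eigenvalue has modulus 1/a0 > 1/a, and its eigenvector bounds 1 / |W n| by
    a geometric sequence whose ratio a0 is still below a. *)
Lemma point_spectral_radius_decay (a : R) :
  ((point_spectral_radius B)%:E^-1 < a%:E)%E ->
  exists a0 C, [/\ 0 < a0, a0 < a, 0 <= C & forall n, `|W n|^-1 <= C * a0 ^+ n].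
Proof.
rewrite inver; case: eqVneq => [|r0]; first by rewrite ltNge leey.
rewrite lte_fin => ra.
have hs : has_sup [set modulus mu | mu in point_spectrum B].
  by apply: contrapT => /sup_out r0'; move/eqP: r0; apply.
have rp : 0 < point_spectral_radius B.
  rewrite lt_def r0/=; have [[_ [mu Hmu _]] _] := hs.
  apply: (le_trans (modulus_ge0 mu)); apply: ub_le_sup; [exact: hs.2|by exists mu].
have a_gt0 : 0 < a by rewrite (lt_trans _ ra)// invr_gt0.
have aVr : a^-1 < point_spectral_radius B by rewrite -[ltRHS]invrK ltf_pV2 ?posrE ?invr_gt0.
have [|_ [mu Hmu <-]] := @sup_adherent R _ (point_spectral_radius B - a^-1) _ hs.
  by rewrite subr_gt0.
rewrite -/(point_spectral_radius B) subKr => amu.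
have m0 : 0 < modulus mu by rewrite (lt_trans _ amu)// invr_gt0.
have [|C C0 HC] := @point_spectrum_decay mu _ Hmu; first by rewrite -modulus_gt0.
exists (modulus mu)^-1, C; split => //; first by rewrite invr_gt0.
by rewrite -[ltRHS]invrK ltf_pV2 ?posrE ?invr_gt0.
Qed.

End weighted_shift_theory.

(** * Obstructions to common frequent hypercyclicity *)

(** Sort the sets by the D and N with n < D #(E a /\ [0, n]) for n >= N: if some
    sort contained infinitely many of them, then D + 1 sets of density at least
    1/D would be almost disjoint, which is more than the integers can hold. *)
Lemma almost_disjoint_countable {R : realType} {T : pointedType} (A : set T)
    (E : T -> set nat) :
  (forall a, A a -> 0 < lower_density R (E a))%E ->
  (forall a b, A a -> A b -> a <> b ->
    exists N, forall n, (N <= n)%N -> ~ (E a n /\ E b n)) ->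
  countable A.
Proof.
move=> Edens Edisj.
pose A_ D N := [set a | A a /\ forall n, (N <= n)%N -> (n < D * counting_fun (E a) n)%N].
have -> : A = \bigcup_D \bigcup_N A_ D N.
  apply/seteqP; split => [a Aa|a [D _ [N _ []]]//].
  by have /lower_density_gt0P[D [N H]] := Edens a Aa; exists D => //; exists N.
apply: bigcup_countable => // D _; apply: bigcup_countable => // N _.
apply: finite_set_countable; apply: contrapT => /infiniteP/ppcard_leP[f].
have fA i : A_ D N (f i) by exact: funS.
have f_inj i j : f i = f j -> i = j by move=> /(@inj _ _ _ f); apply; exact: in_setT.
have sep (ij : 'I_D.+1 * 'I_D.+1) : exists M, ij.1 != ij.2 ->
    forall n, (M <= n)%N -> ~ (E (f ij.1) n /\ E (f ij.2) n).
  case: ij => i j /=; have [->|ij] := eqVneq i j; first by exists 0%N.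
  have [||fij|M HM] := Edisj (f i) (f j); [exact: (fA i).1|exact: (fA j).1| |by exists M].
  by move/negP: ij; apply; apply/eqP/val_inj/f_inj.
have {sep}[M /= HM] := choice sep.
(* From N' on, an integer lies in at most one of the first D + 1 sets. *)
pose N' := (\max_ij M ij)%N.
have HN' (i j : 'I_D.+1) n : i != j -> (N' <= n)%N -> ~ (E (f i) n /\ E (f j) n).
  move=> ij Nn; apply: (HM (i, j) ij n); apply: leq_trans Nn.
  exact: (leq_bigmax (F := M)).
have overlap m : (\sum_(i < D.+1) (m \in E (f i)) <= D.+1 * (m < N') + 1)%N.
  have [mN|Nm] := ltnP m N'.
    rewrite muln1 addn1 leqW// -[leqRHS]card_ord -sum1_card.
    by apply: leq_sum => i _; exact: leq_b1.
  rewrite muln0 add0n; have [[i Ei]|nE] := pselect (exists i : 'I_D.+1, E (f i) m).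
    rewrite (bigD1 i)//= big1 ?addn0 ?leq_b1// => j ji.
    apply/eqP; rewrite eqb0; apply/negP => /set_mem Ej.
    by apply: (HN' j i m).
  rewrite big1// => i _; apply/eqP; rewrite eqb0; apply/negP => /set_mem Ei.
  by apply: nE; exists i.
pose n := maxn N (D * (D.+1 * N')).
have upper : (\sum_(i < D.+1) counting_fun (E (f i)) n <= D.+1 * N' + n.+1)%N.
  rewrite /counting_fun exchange_big/=.
  apply: (@leq_trans (\sum_(m < n.+1) (D.+1 * (m < N') + 1))); first exact: leq_sum.
  rewrite big_split/= sum1_card card_ord leq_add2r -big_distrr/= leq_mul2l.
  apply/orP; right; apply: leq_trans (@counting_fun_bounded [set i | i < N']%N n N' _) => //.
  by apply: leq_sum => i _; case: (ltnP i N') => // iN; rewrite mem_set.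
have lower : (D.+1 * n.+1 <= D * \sum_(i < D.+1) counting_fun (E (f i)) n)%N.
  rewrite big_distrr/= -[X in (X * _)%N]card_ord -sum_nat_const; apply: leq_sum => i _.
  by apply: (fA i).2; exact: leq_maxl.
have nN : (D * (D.+1 * N') <= n)%N by exact: leq_maxr.
have := leq_trans lower (leq_mul (leqnn D) upper).
nia.
Qed.

Lemma exists_root_gt1 {R : realType} (t : R) n : 1 < t ->
  exists2 b, 1 < b & b ^+ n.+1 = t.
Proof.
move=> t1; have t0 : 0 <= t by rewrite (le_trans ler01)// ltW.
exists (t `^ n.+1%:R^-1).
  have one : 1 `^ n.+1%:R^-1 = 1 :> R by rewrite powR1.
  by rewrite -[X in X < _]one; apply: gt0_ltr_powR; rewrite ?invr_gt0 ?nnegrE.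
by rewrite -powR_mulrn ?powR_ge0// -powRrM mulVf ?powRr1// pnatr_eq0.
Qed.

Section obstructions.
Context {R : realType} {k : scalars} {p : R} {p1 : 1 <= p}.
Local Notation K := (scalar_field R k).
Local Notation lp := (lp k p1).
Variable w : nat -> R.
Hypothesis w_neq0 : forall n, w n != 0.
Hypothesis Bw : bounded_shift k p1 w.
Local Notation B := (weighted_shift Bw).
Local Notation scaled l := (fun x => of_real k l *: B x).
Local Notation W := (weight_prod w).
Implicit Types (l m : R).

Let e0_in_lp : (fun n => (n == 0)%:R : K) \in lp_pred p1.
Proof.
apply: (@geometric_in_lp _ _ _ _ _ 1 2^-1) => // [|n].
  by rewrite invr_gt0 ltr0n invf_lt1// ltr1n.
rewrite mul1r; case: n => [|n]; first by rewrite expr0 modulus1.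
by rewrite modulus0 exprn_ge0// invr_ge0.
Qed.

Let e0 : lp := Lp e0_in_lp.

Variable x : lp.

Definition visits_e0 l := [set n | nrm (e0 - iter n (scaled l) x) < 2^-1].
Definition visits_0 l := [set n | nrm (0 - iter n (scaled l) x) < 1].

Lemma iter_scaled_shift0 l n : 0 < l ->
  modulus (iter n (scaled l) x 0%N) = l ^+ n * (`|W n| * modulus (x n)).
Proof.
move=> l0; rewrite iter_scaled_shift// modulusM modulus_of_real addn0 normrM.
rewrite normrX (gtr0_norm l0) normrM normrV ?unitfE ?weight_prod_neq0//.
by rewrite {2}/weight_prod big_ord0 normr1 invr1 mulr1 mulrA.
Qed.

Lemma visits_e0_bounds l n : 0 < l -> visits_e0 l n ->
  2^-1 < l ^+ n * (`|W n| * modulus (x n)) < 2^-1 * 3.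
Proof.
move=> l0; rewrite /visits_e0/= => H.
rewrite -iter_scaled_shift0//; set y := iter n _ x in H *.
have H0 : modulus (1 - y 0%N) < 2^-1.
  by apply: le_lt_trans H; exact: (modulus_le_nrm (e0 - y) 0).
have := ler_modulusB 1 (y 0%N); have := ler_modulusB (y 0%N) 1.
rewrite -[modulus (y 0%N - 1)]modulusN opprB modulus1 => ? ?.
apply/andP; split; lra.
Qed.

(** Two orbits of the same vector constrain each other. If the m-orbit is near 0
    at time n then |B^n x| < m^-n, and if the l-orbit is near e_0 at time N then
    |B^N x| > l^-N / 2; the norm of B^(N - n) limits the growth from n to N. *)
Lemma visits_growth l m n N c : 0 < l -> 0 < m -> (n <= N)%N ->
  visits_0 m n -> visits_e0 l N -> 0 <= c ->
  (forall y, nrm (iter (N - n) B y) <= c * nrm y) -> m ^+ n <= 2 * c * l ^+ N.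
Proof.
move=> l0 m0 nN; rewrite /visits_0/= sub0r nrmN iter_scaled_shiftZ nrmZ.
rewrite modulusX modulus_of_real gtr0_norm// => Hm HlN c0 Hc.
have /andP[Hl _] := visits_e0_bounds l0 HlN.
have ZN : l ^+ N * (`|W N| * modulus (x N)) <= l ^+ N * nrm (iter N B x).
  have := modulus_le_nrm (iter N (scaled l) x) 0.
  by rewrite iter_scaled_shift0// iter_scaled_shiftZ nrmZ modulusX modulus_of_real (gtr0_norm l0).
have BN : nrm (iter N B x) <= c * nrm (iter n B x).
  by rewrite -{1}(subnK nN) iterD.
have lN0 : 0 < l ^+ N by rewrite exprn_gt0.
have mn0 : 0 < m ^+ n by rewrite exprn_gt0.
have H1 : 2^-1 < l ^+ N * (c * nrm (iter n B x)).
  by rewrite (lt_le_trans Hl)// (le_trans ZN)// ler_pM2l.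
have H2 : m ^+ n * 2^-1 <= m ^+ n * (l ^+ N * (c * nrm (iter n B x))).
  by rewrite ler_pM2l// ltW.
have H3 : m ^+ n * (l ^+ N * (c * nrm (iter n B x))) <= l ^+ N * c.
  rewrite (_ : _ * _ = (l ^+ N * c) * (m ^+ n * nrm (iter n B x))); last by ring.
  by rewrite ler_piMr ?mulr_ge0// ltW.
have := le_trans H2 H3; lra.
Qed.

Let half_gt0 : 0 < 2^-1 :> R. Proof. by rewrite invr_gt0. Qed.

Lemma FHC_visits_e0 l : FHC R (scaled l) x -> (0 < lower_density R (visits_e0 l))%E.
Proof. by move=> /FHCP/(_ e0 _ half_gt0). Qed.

Lemma FHC_visits_0 l : FHC R (scaled l) x -> (0 < lower_density R (visits_0 l))%E.
Proof. by move=> /FHCP/(_ 0 _ ltr01). Qed.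

(** At a visit n of the l-orbit to e_0 the number |W n x_n| is l^-n up to a factor
    between 1/2 and 3/2, so that distinct l have almost disjoint visit times. *)
Lemma common_FHC_countable (L : set R) : L `<=` [set l | 0 < l] ->
  (forall l, L l -> FHC R (scaled l) x) -> countable L.
Proof.
move=> L0 FHCL; apply: (@almost_disjoint_countable R R L visits_e0).
  by move=> l Ll; exact/FHC_visits_e0/FHCL.
have disj l m : L l -> L m -> l < m ->
    exists N, forall n, (N <= n)%N -> ~ (visits_e0 l n /\ visits_e0 m n).
  move=> /L0/= l0 /L0/= m0 lm.
  have [|N HN] := @geometric_eventually_gt R 3 (m / l); first by rewrite ltr_pdivlMr ?mul1r.
  exists N => n /HN; rewrite expr_div_n ltr_pdivlMr ?exprn_gt0// => H [].
  move=> /(visits_e0_bounds l0)/andP[Hl _] /(visits_e0_bounds m0)/andP[_ Hm].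
  set Z := `|W n| * _ in Hl Hm.
  have Z0 : 0 < Z by rewrite -(pmulr_rgt0 Z (exprn_gt0 n l0)) (lt_trans half_gt0).
  have : 3 * l ^+ n * Z < m ^+ n * Z by rewrite ltr_pM2r.
  lra.
move=> l m Ll Lm /eqP; rewrite neq_lt => /orP[lm|ml]; first exact: disj.
have [N HN] := disj _ _ Lm Ll ml; exists N => n /HN H [? ?]; exact: H.
Qed.

(** Fix l. The visits of the l-orbit to e_0 have gap ratio at most some Q. Once
    m is huge, an m-orbit near 0 at time n is still too small at all times up to
    Q n for the l-orbit to visit e_0. *)
Lemma unbounded_no_common_FHC (L : set R) : L `<=` [set l | 0 < l] -> L !=set0 ->
  (forall M, exists2 m, L m & M < m) -> ~ (forall l, L l -> FHC R (scaled l) x).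
Proof.
move=> L0 [l Ll] Lub FHCL; have l0 := L0 _ Ll.
have [Q [N [Q0 HQ]]] := lower_density_gt0_gap (FHC_visits_e0 (FHCL _ Ll)).
have [c0 c0_ge0 Hc0] := shift_bounded Bw.
pose c := Num.max c0 1; pose l' := Num.max l 1.
have c1 : 1 <= c by rewrite le_max lexx orbT.
have l1 : 1 <= l' by rewrite le_max lexx orbT.
have ll' : l <= l' by rewrite le_max lexx.
have c_ge0 : 0 <= c by rewrite (le_trans ler01).
have Hc n y : nrm (iter n B y) <= c ^+ n * nrm y.
  elim: n => [|n IH]; first by rewrite expr0 mul1r.
  rewrite iterS exprS -mulrA (le_trans (Hc0 _))// ler_pM ?nrm_ge0//.
  by rewrite le_max lexx.
have cl1 : 1 <= c * l' by rewrite mulr_ege1.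
(* This m beats the largest growth 2 (c l')^(Q n) possible up to time Q n. *)
have [m Lm Hm] := Lub (4 * (c * l') ^+ Q); have m0 := L0 _ Lm.
have [Q' [N' [_ HQ']]] := lower_density_gt0_gap (FHC_visits_0 (FHCL _ Lm)).
have [n En /andP[nN _]] := HQ' (maxn N' (maxn N 1)) (leq_maxl _ _).
have [|e Ee /andP[ne eQ]] := HQ n; first by rewrite (leq_trans _ nN)// !leq_max leqnn orbT.
have n0 : (0 < n)%N by rewrite (leq_trans _ nN)// !leq_max !orbT.
have := visits_growth l0 m0 ne En Ee (exprn_ge0 (e - n) c_ge0) (Hc _).
apply/negP; rewrite -ltNge.
have Qn : c ^+ (e - n) * l ^+ e <= (c * l') ^+ (Q * n).
  apply: (@le_trans _ _ (c ^+ e * l' ^+ e)).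
    rewrite ler_pM ?exprn_ge0 ?(ltW l0)// ?ler_weXn2l ?leq_subr//.
    by rewrite lerXn2r ?nnegrE ?(ltW l0) ?(le_trans ler01).
  by rewrite -exprMn ler_weXn2l.
apply: (@le_lt_trans _ _ (2 * (c * l') ^+ (Q * n))); first by rewrite -mulrA ler_pM2l.
have P0 : 0 < (c * l') ^+ (Q * n) by rewrite exprn_gt0// (lt_le_trans ltr01).
apply: (@lt_le_trans _ _ (4 ^+ n * (c * l') ^+ (Q * n))).
  rewrite ltr_pM2r// -(prednK n0) exprS; apply: (@lt_le_trans _ _ 4); first by rewrite ltr_nat.
  by rewrite ler_peMr// exprn_ege1// ler1n.
rewrite exprM -exprMn lerXn2r ?nnegrE ?(ltW m0) ?(ltW Hm)// mulr_ge0// exprn_ge0//.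
by rewrite (le_trans ler01).
Qed.

(** Now m is fixed and l tends to inf L. As l r is then at most about 1, the
    l-orbit needs a time much longer than e to make up for the factor (m / l)^e;
    hence before a visit M of the l-orbit to e_0 the m-orbit stays away from 0 on
    a long interval [M / Q, M], against the positive density of its visits to 0. *)
Lemma inf_le_no_common_FHC (L : set R) : L `<=` [set l | 0 < l] ->
  (exists l m, [/\ L l, L m & l != m]) ->
  ((inf L)%:E <= (spectral_radius B)%:E^-1)%E ->
  ~ (forall l, L l -> FHC R (scaled l) x).
Proof.
move=> L0 [l1 [l2 [Ll1 Ll2 l12]]] infr FHCL.
have hasL : has_inf L by split; [exists l1|exists 0 => l /L0/ltW].
have [m Lm infm] : exists2 m, L m & inf L < m.
  have i1 := ge_inf hasL.2 Ll1; have i2 := ge_inf hasL.2 Ll2.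
  have [e1|n1] := eqVneq (inf L) l1; last by exists l1; rewrite // lt_neqAle n1.
  by exists l2; rewrite // lt_neqAle i2 e1 l12.
have m0 := L0 _ Lm.
have [n infn nm] : exists2 n, inf L < n & n < m.
  by exists ((inf L + m) / 2); [exact: (midf_lt infm).1|exact: (midf_lt infm).2].
have inf0 : 0 <= inf L by apply: lb_le_inf hasL.1 _ => l /L0/ltW.
have n0 : 0 < n by exact: le_lt_trans infn.
have [Q [N [Q0 HQ]]] := lower_density_gt0_gap (FHC_visits_0 (FHCL _ Lm)).
(* b is so close to 1 that b^(2 Q e) does not reach (m / n)^e. *)
have [|b b1 bE] := @exists_root_gt1 R (m / n) (2 * Q); first by rewrite ltr_pdivlMr ?mul1r.
have b0 : 0 < b by exact: lt_trans b1.
have [c0 c0_ge0 Hc0] := shift_bounded Bw.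
have [r0 Hr] := spectral_radius_growth c0_ge0 Hc0 (@shiftZ _ _ _ _ _ Bw).
set r := spectral_radius B in infr r0 Hr.
have [l Ll /andP[ln lrb]] : exists2 l, L l & (l < n) && (l * r < b).
  have [rE|rn0] := eqVneq r 0.
    have [|l Ll] := @inf_adherent R L (n - inf L) _ hasL; first by rewrite subr_gt0.
    by rewrite addrC subrK => ln; exists l; rewrite // ln rE mulr0.
  have rp : 0 < r by rewrite lt_def rn0.
  have infbr : inf L < b / r.
    move: infr; rewrite inver (negbTE rn0) lee_fin => /le_lt_trans; apply.
    by rewrite ltr_pMl ?invr_gt0.
  have [|l Ll] := @inf_adherent R L (Num.min n (b / r) - inf L) _ hasL.
    by rewrite subr_gt0 lt_min infn infbr.
  rewrite addrC subrK lt_min => /andP[ln lbr]; exists l => //.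
  by rewrite ln -ltr_pdivlMr.
have l0 := L0 _ Ll.
have [|C C0 HC] := Hr (b / l); first by rewrite ltr_pdivlMr// mulrC.
have [Nb HNb] := @geometric_eventually_gt R (2 * C) b b1.
have [Q' [N' [_ HQ']]] := lower_density_gt0_gap (FHC_visits_e0 (FHCL _ Ll)).
pose t := maxn (maxn N Nb) 1.
have [M EM /andP[MN _]] := HQ' (maxn N' (Q * t)) (leq_maxl _ _).
have tM : (Q * t <= M)%N by rewrite (leq_trans _ MN)// leq_maxr.
have tMQ : (t <= M %/ Q)%N by rewrite leq_divRL// mulnC.
have [|e Ee /andP[Me eM]] := HQ (M %/ Q)%N; first by rewrite (leq_trans _ tMQ)// !leq_max leqnn.
have te : (t <= e)%N by exact: leq_trans Me.
have e1 : (1 <= e)%N by rewrite (leq_trans _ te)// leq_max leqnn orbT.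
have bigC : 2 * C < b ^+ e by apply: HNb; rewrite (leq_trans _ te)// !leq_max leqnn !orbT.
have eM' : (e <= M)%N by rewrite (leq_trans eM)// mulnC leq_trunc_div.
have MeQ : (M - e <= 2 * Q * e)%N.
  have MQ : (M < Q * (M %/ Q).+1)%N by rewrite mulnC ltn_ceil.
  rewrite (leq_trans (leq_subr _ _))// (leq_trans (ltnW MQ))// -mulnA mulnCA leq_mul2l.
  by rewrite mul2n -addnn -addn1 leq_add// orbT.
have blM : 0 <= C * (b / l) ^+ (M - e).
  by rewrite mulr_ge0 ?(ltW C0) ?exprn_ge0 ?divr_ge0 ?(ltW b0) ?(ltW l0).
have := visits_growth l0 m0 eM' Ee EM blM (HC _).
rewrite -{2}(subnK eM') exprD expr_div_n.
have -> : 2 * (C * (b ^+ (M - e) / l ^+ (M - e))) * (l ^+ (M - e) * l ^+ e) =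
    2 * C * b ^+ (M - e) * l ^+ e.
  by field; rewrite expf_neq0// gt_eqF.
apply/negP; rewrite -ltNge -ltr_pdivlMr ?exprn_gt0//.
apply: (@le_lt_trans _ _ (2 * C * b ^+ (2 * Q * e))).
  by rewrite ler_pM2l ?mulr_gt0// ler_weXn2l// ltW.
apply: (@lt_le_trans _ _ (b ^+ e * b ^+ (2 * Q * e))).
  by rewrite ltr_pM2r// exprn_gt0.
rewrite -exprD -mulSn exprM bE -expr_div_n lerXn2r ?nnegrE ?divr_ge0 ?(ltW m0) ?(ltW n0) ?(ltW l0)//.
by rewrite ler_pM2l// lef_pV2 ?posrE// ltW.
Qed.

End obstructions.

(** * A common frequently hypercyclic vector *)

(** The 2-adic valuation distributes the integers over countably many classes,
    each of which has bounded gaps. *)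
Lemma logn2_syndetic i K : exists k,
  [/\ (K <= k)%N, (k <= K + 2 ^ i.+2)%N & logn 2 k = i].
Proof.
pose j := (K %/ 2 ^ i.+1).+1; exists (2 ^ i * j.*2.+1)%N.
have kE : (2 ^ i * j.*2.+1 = j * 2 ^ i.+1 + 2 ^ i)%N by rewrite expnS; nia.
have Kj : (K < j * 2 ^ i.+1)%N by rewrite ltn_ceil// expn_gt0.
have jK : (j * 2 ^ i.+1 <= K + 2 ^ i.+1)%N by rewrite mulSn addnC leq_add2r leq_trunc_div.
split; first by rewrite kE (leq_trans (ltnW Kj))// leq_addr.
  have := (expnS 2 i.+1, expnS 2 i); rewrite kE => -[-> e1]; rewrite e1 in jK *; lia.
rewrite lognM ?expn_gt0// pfactorK// logn_coprime ?addn0//.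
by rewrite coprime2n/= odd_double.
Qed.

Section blocks.
Variables (q N K i : nat).
Hypotheses (q1 : (1 < q)%N) (N0 : (0 < N)%N) (NK : (N <= K)%N).

(** A block [q^k, 2 q^k] makes up a fixed proportion of the integers up to q^(k+c),
    and yet all later blocks start at least q/2 times further than where it ends.
    The blocks are distributed over the indices i by the 2-adic valuation of k;
    inside a block the times are spaced by N. *)
Definition block_times := [set n : nat | exists k : nat,
  [/\ (K <= k)%N, logn 2 k = i, (q ^ k <= n <= 2 * q ^ k)%N & (N %| n)%N]].

Lemma counting_fun_ge (E : set nat) (n c : nat) (f : 'I_c -> nat) :
  injective f -> (forall u, E (f u) /\ (f u <= n)%N) -> (c <= counting_fun E n)%N.
Proof.
move=> f_inj fE; rewrite /counting_fun.
have -> : (\sum_(m < n.+1) (val m \in E))%N = #|[pred m : 'I_n.+1 | val m \in E]|.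
  by rewrite -sum1_card [RHS]big_mkcond; apply: eq_bigr => m _; rewrite inE; case: (_ \in E).
have f_lt u : (f u < n.+1)%N by rewrite ltnS; exact: (fE u).2.
rewrite -[X in (X <= _)%N]card_ord.
have g_inj : injective (fun u => Ordinal (f_lt u)) by move=> u u' [] /f_inj.
rewrite -(card_codom g_inj); apply: subset_leq_card; apply/fintype.subsetP => _ /codomP[u ->].
exact: (mem_set (fE u).1).
Qed.

Lemma block_times_density (R : realType) : (0 < lower_density R block_times)%E.
Proof.
have q0 : (0 < q)%N by exact: ltnW.
pose G := (2 ^ i.+2)%N.
apply/lower_density_gt0P; exists (q ^ (G + 2) * (2 * N))%N, (q ^ (K + G + 1))%N => n nK.
have n0 : (0 < n)%N by rewrite (leq_trans _ nK)// expn_gt0 q0.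
pose j := trunc_log q n.
have Kj : (K + G + 1 <= j)%N by exact: trunc_log_max.
have [k [jk kj ki]] := logn2_syndetic i (j - G - 1); rewrite -/G in kj.
have kj1 : (k.+1 <= j)%N by lia.
have jk1 : (j.+1 <= k + (G + 2))%N by lia.
have qn : (2 * q ^ k <= n)%N.
  rewrite (leq_trans _ (trunc_logP q1 n0))// (leq_trans _ (leq_pexp2l q0 kj1))//.
  by rewrite expnS leq_mul2r q1 orbT.
have nq : (n < q ^ (G + 2) * q ^ k)%N.
  by rewrite (leq_trans (trunc_log_ltn n q1))// -expnD addnC leq_pexp2l.
have Nk : (N <= k)%N by lia.
have Nq : (N <= q ^ k)%N by rewrite (leq_trans Nk)// ltnW// ltn_expl.
pose c := (q ^ k %/ N)%N.
have c0 : (0 < c)%N by rewrite divn_gt0.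
have cq : (N * c <= q ^ k)%N by rewrite mulnC leq_trunc_div.
have qc : (q ^ k < N * c.+1)%N by rewrite mulnC ltn_ceil.
have count : (c <= counting_fun block_times n)%N.
  apply: (@counting_fun_ge _ _ _ (fun u : 'I_c => (N * (c + u.+1))%N)) => [u u' /eqP|u].
    by rewrite eqn_pmul2l// eqn_add2l eqSS => /eqP/val_inj.
  have hi : (N * (c + u.+1) <= 2 * q ^ k)%N.
    rewrite mulnDr mul2n -addnn leq_add// (leq_trans _ cq)// leq_mul2l.
    by rewrite ltn_ord orbT.
  split; last exact: leq_trans qn.
  exists k; split=> //; [by lia| |exact: dvdn_mulr].
  by rewrite hi andbT (leq_trans (ltnW qc))// leq_mul2l addnS ltnS leq_addr orbT.
apply: (leq_trans nq); rewrite -mulnA leq_mul2l; apply/orP; right.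
rewrite (leq_trans (ltnW qc))// -mulnA mulnCA leq_mul2l; apply/orP; right.
by rewrite (leq_trans _ (leq_mul (leqnn 2) count))// mul2n -addnn -addn1 leq_add2l.
Qed.

End blocks.

Section block_sequence.
Context {R : realType} {k : scalars}.
Local Notation K := (scalar_field R k).
Variables (a0 a b sigma : R) (q : nat).
Variables (la : nat -> R) (v : nat -> seq K) (N : nat -> nat) (M eta : nat -> R).
Hypotheses (a0_gt0 : 0 < a0) (s0 : 0 < sigma) (s1 : sigma < 1).
Hypothesis a0_le : a0 <= sigma ^+ 4 * a.
Hypothesis la_ab : forall i, a <= la i <= b.
Hypotheses (q3 : (3 <= q)%N) (qE : (b / a0) ^+ 2 * sigma ^+ q <= 1).
Hypothesis vM : forall i t, modulus (v i)`_t * a0 ^+ t <= M i * sigma ^+ t.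
Hypothesis vN : forall i, (size (v i) <= N i)%N.
Hypothesis N0 : forall i, (0 < N i)%N.
Hypothesis NM : forall i, sigma ^+ N i * M i <= eta i.
Hypothesis Neta : forall i, sigma ^+ N i <= eta i.
Hypothesis eta1 : forall i, eta i <= 1.

(** The word la_i^-m v_i is written at every time m of the i-th family of blocks,
    where the m-th iterate for the parameter la_i finds v_i. Words do not overlap,
    since v_i is no longer than the spacing N i. *)
Definition block_seq (s : nat) : K :=
  let k := trunc_log q s in let i := logn 2 k in
  let t := (s %% N i)%N in let m := (s - t)%N in
  if [&& (N i <= k)%N, (q ^ k <= m)%N & (m <= 2 * q ^ k)%N]
  then of_real _ (la i ^+ m)^-1 * (v i)`_t else 0.

Let q1 : (1 < q)%N. Proof. exact: ltn_trans q3. Qed.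
Let q0 : (0 < q)%N. Proof. exact: ltn_trans q3. Qed.

Let sX n : 0 < sigma ^+ n. Proof. exact: exprn_gt0. Qed.

Let sX_le m n : (m <= n)%N -> sigma ^+ n <= sigma ^+ m.
Proof. by move=> mn; rewrite ler_wiXn2l ?(ltW s0) ?(ltW s1). Qed.

Let M_ge0 i : 0 <= M i.
Proof.
have := vM i 0; rewrite !expr0 !mulr1; apply: le_trans; exact: modulus_ge0.
Qed.

Let a_gt0 : 0 < a.
Proof. by rewrite -(pmulr_rgt0 _ (sX 4)) (lt_le_trans a0_gt0). Qed.

Let la_gt0 i : 0 < la i.
Proof. by have /andP[+ _] := la_ab i; exact: lt_le_trans. Qed.

Let ratio_le i : a0 / la i <= sigma ^+ 4.
Proof.
rewrite ler_pdivrMr// (le_trans a0_le)// ler_pM2l//.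
by have /andP[] := la_ab i.
Qed.

(* Moving a word to the right by d shrinks it by sigma^(4 d); one quarter of
   that exponent absorbs the constant of the word. *)
Let word_far i t d : (N i <= d)%N ->
  (a0 / la i) ^+ d * (modulus (v i)`_t * a0 ^+ t) <= eta i * sigma ^+ (3 * d + t).
Proof.
move=> Nd; have r0 : 0 <= a0 / la i by rewrite divr_ge0 ?ltW.
apply: (@le_trans _ _ (sigma ^+ 4 ^+ d * (M i * sigma ^+ t))).
  have rd0 := exprn_ge0 d r0.
  have vt0 : 0 <= modulus (v i)`_t * a0 ^+ t by rewrite mulr_ge0 ?modulus_ge0 ?exprn_ge0 ?ltW.
  by rewrite ler_pM// lerXn2r ?nnegrE// ltW.
rewrite -exprM mulrCA -exprD (_ : 4 * d + t = d + (3 * d + t))%N; last by rewrite mulSn addnA.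
rewrite exprD mulrA ler_pM2r// (le_trans _ (NM i))// mulrC ler_wpM2r//.
exact: sX_le.
Qed.

Let block_shift i m t : modulus (of_real k (la i ^+ m)^-1 * (v i)`_t) =
  (la i ^+ m)^-1 * modulus (v i)`_t.
Proof.
by rewrite modulusM modulus_of_real gtr0_norm// invr_gt0 exprn_gt0.
Qed.

Lemma block_seq_decay s : modulus (block_seq s) * a0 ^+ s <= sigma ^+ s.
Proof.
rewrite /block_seq; set k' := trunc_log q s; set i := logn 2 k'.
set t := (s %% N i)%N; set m := (s - t)%N.
case: ifP => [/and3P[Nk qm mq]|_]; last by rewrite modulus0 mul0r ltW.
have sE : s = (m + t)%N by rewrite subnK// leq_mod.
have Nm : (N i <= m)%N.
  by rewrite (leq_trans Nk)// (leq_trans _ qm)// ltnW// ltn_expl.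
rewrite block_shift [in a0 ^+ _]sE exprD.
have -> : (la i ^+ m)^-1 * modulus (v i)`_t * (a0 ^+ m * a0 ^+ t) =
   (a0 / la i) ^+ m * (modulus (v i)`_t * a0 ^+ t).
  by rewrite expr_div_n; ring.
rewrite (le_trans (word_far t Nm))// (@le_trans _ _ (sigma ^+ (3 * m + t)))//.
  by rewrite ler_piMl// ltW.
by apply: sX_le; rewrite [X in (X <= _)%N]sE leq_add2r leq_pmull.
Qed.

(** After n steps with the parameter la_i the word v_i is in front, and what
    follows is small. Words of the same block are damped by their distance, which
    is at least N i. A word of a later block, at a time m, was not scaled for la_i,
    and the discrepancy may be as large as (b / a0)^n; but n <= (2 / q) m, so that
    sigma^m absorbs it. *)
Lemma block_seq_visit i n s : block_times q (N i) (N i) i n ->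
  modulus (of_real _ (la i ^+ n) * block_seq (n + s) - (v i)`_s) * a0 ^+ s
    <= eta i * sigma ^+ s.
Proof.
move=> [j [Nj ji /andP[qn nq] Nn]].
have eta0 : 0 <= eta i by rewrite (le_trans _ (Neta i))// ltW.
have rhs0 : 0 <= eta i * sigma ^+ s by rewrite mulr_ge0 ?exprn_ge0 ?(ltW s0).
have Nqj : (N i < q ^ j)%N by rewrite (leq_ltn_trans Nj)// ltn_expl.
have qj0 : (0 < q ^ j)%N by rewrite expn_gt0 q0.
have ns0 : (0 < n + s)%N by rewrite ltn_addr// (leq_trans qj0).
have jk : (j <= trunc_log q (n + s))%N by rewrite trunc_log_max// (leq_trans qn)// leq_addr.
rewrite /block_seq; set k' := trunc_log q (n + s) in jk *; set i' := logn 2 k'.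
set t := ((n + s) %% N i')%N; set m := (n + s - t)%N.
have [kj|kj] := eqVneq k' j.
  (* The position n + s lies in the block of n. *)
  have i'E : i' = i by rewrite /i' kj ji.
  have tE : t = (s %% N i)%N by rewrite /t i'E -modnDml (eqP Nn) add0n.
  have [sN|Ns] := ltnP s (N i).
    have {}tE : t = s by rewrite tE modn_small.
    have mE : m = n by rewrite /m tE addnK.
    rewrite mE tE i'E kj qn nq Nj/= mulrA -of_realM divff ?expf_neq0 ?gt_eqF//.
    by rewrite of_real1 mul1r subrr modulus0 mul0r.
  rewrite [X in _ - X]nth_default ?subr0; last exact: leq_trans Ns.
  case: ifP => _; last by rewrite mulr0 modulus0 mul0r.
  pose d := (s - t)%N.
  have ts : (t <= s)%N by rewrite tE leq_mod.
  have sE : s = (d + t)%N by rewrite subnK.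
  have mE : m = (n + d)%N by rewrite /m /d addnBA.
  have Nd : (N i <= d)%N.
    by rewrite /d tE {1}(divn_eq s (N i)) addnK leq_pmull// divn_gt0.
  rewrite i'E modulusM block_shift modulus_of_real gtr0_norm ?exprn_gt0//.
  rewrite mE [in a0 ^+ _]sE !exprD.
  have -> : la i ^+ n * ((la i ^+ n * la i ^+ d)^-1 * modulus (v i)`_t) * (a0 ^+ d * a0 ^+ t) =
      (a0 / la i) ^+ d * (modulus (v i)`_t * a0 ^+ t).
    by rewrite expr_div_n; field; rewrite !expf_neq0// gt_eqF.
  rewrite (le_trans (word_far t Nd))// ler_wpM2l// [in leRHS]sE.
  by apply: sX_le; rewrite leq_add2r leq_pmull.
(* The position n + s lies in a later block. *)
have {}jk : (j < k')%N by rewrite ltn_neqAle eq_sym kj.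
have qk : (q ^ j.+1 <= q ^ k')%N by rewrite leq_pexp2l.
have qj3 : (3 * q ^ j <= q ^ j.+1)%N by rewrite expnS leq_mul2r q3 orbT.
have kns : (q ^ k' <= n + s)%N by exact: trunc_logP.
rewrite [X in _ - X]nth_default ?subr0; last first.
  rewrite (leq_trans (vN i))// (leq_trans (ltnW Nqj))// -(leq_add2l n).
  rewrite (leq_trans _ kns)// (leq_trans _ qk)// (leq_trans _ qj3)//.
  by rewrite (mulSn 2) addnC leq_add2l.
case: ifP => [/and3P[Nk qm mq]|_]; last by rewrite mulr0 modulus0 mul0r.
have sE : (n + s = m + t)%N by rewrite subnK// leq_mod.
have Nm : (N i' <= m)%N.
  by rewrite (leq_trans Nk)// (leq_trans _ qm)// ltnW// ltn_expl.
rewrite modulusM block_shift modulus_of_real gtr0_norm ?exprn_gt0//.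
have an : a0 ^+ n != 0 by rewrite expf_neq0// gt_eqF.
have -> : la i ^+ n * ((la i' ^+ m)^-1 * modulus (v i')`_t) * a0 ^+ s =
    (la i / a0) ^+ n * ((a0 / la i') ^+ m * (modulus (v i')`_t * a0 ^+ t)).
  apply: (mulIf an); rewrite -[LHS]mulrA -exprD [(s + n)%N]addnC sE exprD !expr_div_n.
  by field; rewrite an expf_neq0// gt_eqF.
have ba1 : 1 <= b / a0.
  rewrite ler_pdivlMr// mul1r (le_trans a0_le)//.
  have /andP[+ +] := la_ab 0 => /le_trans/[apply]; apply: le_trans.
  by rewrite ler_piMl ?(ltW a_gt0)// exprn_ile1 ?ltW.
have ba0 : 0 < b / a0 by exact: lt_le_trans ba1.
have lar0 : 0 < la i / a0 by rewrite divr_gt0.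
have growth : (la i / a0) ^+ n <= ((b / a0) ^+ 2) ^+ (q ^ j).
  apply: (@le_trans _ _ ((b / a0) ^+ n)).
    rewrite lerXn2r ?nnegrE ?(ltW lar0) ?(ltW ba0)//.
    by rewrite ler_pM2r ?invr_gt0//; have /andP[] := la_ab i.
  by rewrite -exprM ler_weXn2l.
have absorb : (la i / a0) ^+ n * sigma ^+ m <= 1.
  apply: (@le_trans _ _ (((b / a0) ^+ 2 * sigma ^+ q) ^+ (q ^ j))).
    rewrite [leRHS]exprMn -(exprM sigma) -expnS ler_pM ?exprn_ge0 ?(ltW s0) ?(ltW lar0)//.
    by apply: sX_le; rewrite (leq_trans qk).
  by rewrite exprn_ile1// mulr_ge0 ?exprn_ge0 ?(ltW s0) ?(ltW ba0).
apply: (@le_trans _ _ ((la i / a0) ^+ n * sigma ^+ (3 * m + t))).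
  rewrite ler_wpM2l ?exprn_ge0 ?(ltW lar0)//.
  rewrite (le_trans (word_far t Nm))// ler_piMl// ltW//.
rewrite (_ : 3 * m + t = m + (m + (m + t)))%N; last by rewrite !mulSn mul0n addn0 -!addnA.
rewrite exprD mulrA (@le_trans _ _ (sigma ^+ (m + (m + t))))//.
  by rewrite ler_piMl// ltW.
rewrite exprD ler_pM ?(ltW (sX _))//.
  rewrite (le_trans _ (Neta i))// sX_le//.
  exact: leq_trans (ltnW Nqj) (leq_trans (leq_pexp2l q0 (ltnW jk)) qm).
by rewrite -sE sX_le// leq_addl.
Qed.

End block_sequence.

(** The constant attached to a finite word, in the form in which the geometric
    estimates use it. *)
Lemma finite_support_geometric {R : realType} (f : nat -> R) (s : R) d :
  0 < s -> (forall n, 0 <= f n) -> (forall n, (d <= n)%N -> f n = 0) ->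
  exists2 M, 0 <= M & forall n, f n <= M * s ^+ n.
Proof.
move=> s0 f0 fd; have t0 n : 0 <= f n / s ^+ n by rewrite divr_ge0// exprn_ge0// ltW.
exists (\sum_(n < d) f n / s ^+ n) => [|n]; first by rewrite sumr_ge0.
have [dn|nd] := leqP d n; first by rewrite fd// mulr_ge0 ?sumr_ge0 ?exprn_ge0// ltW.
rewrite -ler_pdivrMr ?exprn_gt0// (bigD1 (Ordinal nd))//=.
by rewrite lerDl sumr_ge0.
Qed.

Section rational_words.
Context {R : realType} {k : scalars}.
Local Notation K := (scalar_field R k).

Definition of_rats (q : rat * rat) : K :=
  match k return scalar_field R k with
  | Reals => ratr q.1
  | Complexes => (ratr q.1 +i* ratr q.2)%C
  end.

Lemma of_rats_dense (z : K) (e : R) : 0 < e -> exists q, modulus (z - of_rats q) <= e.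
Proof.
have near_rat (r d : R) : 0 < d -> exists q : rat, `|r - ratr q| <= d.
  move=> d0; have [|q] := @rat_in_itvoo R (r - d) (r + d).
    by rewrite ltrBlDr -addrA ltrDl addr_gt0.
  rewrite in_itv/= => /andP[q1 q2]; exists q; rewrite ler_distlC.
  by apply/andP; split; lra.
move=> e0; rewrite /of_rats; case: k z => [|] z /=.
  by have [q Hq] := near_rat z e e0; exists (q, 0).
case: z => x y; have e2 : 0 < e / 2 by rewrite divr_gt0.
have [q1 H1] := near_rat x _ e2; have [q2 H2] := near_rat y _ e2.
exists (q1, q2); rewrite /Normc.normc/=; set x' := x - _; set y' := y - _.
have xy' : 0 <= `|x'| + `|y'| by rewrite addr_ge0.
apply: (@le_trans _ _ (`|x'| + `|y'|)); last by rewrite [leRHS]splitr lerD.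
rewrite -[leRHS](ger0_norm xy') -[leRHS]sqrtr_sqr ler_wsqrtr// [leRHS]sqrrD !real_normK ?num_real//.
by rewrite lerD2r lerDl mulrn_wge0// mulr_ge0.
Qed.

End rational_words.

Section construction.
Context {R : realType} {k : scalars} {p : R} {p1 : 1 <= p}.
Local Notation K := (scalar_field R k).
Local Notation lp := (lp k p1).
Variable w : nat -> R.
Hypothesis w_neq0 : forall n, w n != 0.
Hypothesis Bw : bounded_shift k p1 w.
Local Notation B := (weighted_shift Bw).
Local Notation scaled l := (fun x => of_real k l *: B x).
Local Notation W := (weight_prod w).

Definition word (v : seq (rat * rat)) : seq K := map of_rats v.

Let p0 : 0 < p. Proof. exact: lt_le_trans p1. Qed.

Lemma lpnorm_tail (y : lp) (e : R) : 0 < e ->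
  exists d, (lpnorm p (fun n => if (n < d)%N then 0 else y n)%R <= e%:E)%E.
Proof.
move=> e0; pose f n := (modulus (y n) `^ p)%:E.
have f0 n : (0 <= f n)%E by rewrite lee_fin powR_ge0.
have fsum : (\sum_(0 <= n <oo) f n < +oo)%E.
  apply: (@lty_poweRy _ _ p^-1); first by rewrite invr_neq0// gt_eqF.
  by have := lp_valP y; rewrite unfold_in.
have ep : 0 < e `^ p by rewrite powR_gt0.
have fin n : (\sum_(n <= m <oo) f m)%E \is a fin_num.
  rewrite ge0_fin_numE ?nneseries_ge0//; apply: le_lt_trans fsum.
  by rewrite [leRHS](nneseries_split 0 n)// add0n leeDr// sume_ge0.
have [d Hd] : exists d, (\sum_(d <= n <oo) f n <= (e `^ p)%:E)%E.
  have /fine_cvgP[_ /cvgrPdist_le/(_ _ ep)[d _ /(_ d (leqnn d))]] :=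
    nneseries_tail_cvg fsum (fun n _ => f0 n).
  rewrite /= sub0r normrN => H; exists d.
  by rewrite -(fineK (fin d)) lee_fin (le_trans (ler_norm _)).
exists d; rewrite /lpnorm.
have -> : (\sum_(0 <= n <oo) (modulus (if (n < d)%N then 0 else y n)%R `^ p)%:E =
    \sum_(d <= n <oo) f n)%E.
  rewrite (nneseries_split 0 d); last by move=> *; rewrite lee_fin powR_ge0.
  rewrite add0n big_nat big1 ?add0e.
    by apply/congr_lim/funext => m; apply: eq_big_nat => n /andP[dn _]; rewrite ltnNge dn.
  by move=> n /andP[_ ->]; rewrite modulus0 powR0// gt_eqF.
rewrite -[leRHS]poweRe1 ?lee_fin ?(ltW e0)// -(mulfV (lt0r_neq0 p0)) poweRrM poweR_EFin.
apply: gt0_ler_poweR => //; first by rewrite invr_ge0 ltW.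
- by rewrite in_itv/= leey andbT nneseries_ge0.
- by rewrite in_itv/= leey andbT lee_fin powR_ge0.
Qed.

(** Countably many targets suffice. They are written as v_n / W n, in the
    coordinates in which the shift is unweighted. *)
Lemma words_dense (y : lp) (e : R) : 0 < e ->
  exists2 u : lp, nrm (y - u) < e &
    exists v, forall n, u n = (of_real k (W n))^-1 * (word v)`_n.
Proof.
move=> e0; have e2 : 0 < e / 2 / 2 by rewrite !divr_gt0.
have h01 : 0 < (2^-1 : R) < 1 by rewrite invr_gt0 ltr0n invf_lt1// ltr1n.
have h0 : 0 < (2^-1 : R) by case/andP: h01.
have [d Hd] := lpnorm_tail y e2.
have W0 n : 0 < modulus (of_real k (W n)) by rewrite modulus_of_real normr_gt0 weight_prod_neq0.
have approx n : exists q : rat * rat,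
    modulus (y n - (of_real k (W n))^-1 * of_rats q) <= e / 2 / 4 * 2^-1 ^+ n.
  have [|q Hq] := @of_rats_dense R k (of_real k (W n) * y n)
    (modulus (of_real k (W n)) * (e / 2 / 4 * 2^-1 ^+ n)).
    by rewrite !mulr_gt0 ?exprn_gt0 ?invr_gt0.
  exists q; rewrite -(ler_pM2l (W0 n)) -modulusM mulrBr mulrA mulfV ?mul1r//.
  by rewrite -modulus_gt0.
have {approx}[g /= Hg] := choice approx.
pose v := mkseq g d.
pose f n : K := (of_real k (W n))^-1 * (word v)`_n.
have szv : size (word v) = d by rewrite size_map size_mkseq.
have vE n : (n < d)%N -> (word v)`_n = of_rats (g n).
  by move=> nd; rewrite (nth_map (0, 0)) ?size_mkseq// nth_mkseq.
have f_lp : f \in lp_pred p1.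
  have [||M M0 HM] := @finite_support_geometric R (fun n => modulus (f n)) 2^-1 d h0.
  - by move=> n; exact: modulus_ge0.
  - by move=> n dn; rewrite /f nth_default ?szv// mulr0 modulus0.
  exact: geometric_in_lp M0 h01 HM.
exists (Lp f_lp); last by exists v.
rewrite -lte_fin -lpnorm_nrm.
pose h n : K := if (n < d)%N then y n - f n else 0.
have -> : lp_val (y - Lp f_lp) = (h + (fun n => if (n < d)%N then 0 else y n))%R.
  apply/funext => n; rewrite -[LHS]/(y n - f n) -[RHS]/(h n + (if (n < d)%N then 0 else y n)).
  rewrite /h; case: ltnP => nd; first by rewrite addr0.
  by rewrite add0r /f nth_default ?szv// mulr0 subr0.
apply: (le_lt_trans (lpnormD _ _ p1)).
have hle : (lpnorm p h <= (e / 2 / 4 / (1 - 2^-1))%:E)%E.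
  apply: lpnorm_geometric => // [|n]; first by rewrite !divr_ge0// ltW.
  rewrite /h; case: ltnP => nd; first by rewrite /f vE.
  by rewrite modulus0 !mulr_ge0 ?exprn_ge0 ?invr_ge0 ?(ltW e0).
apply: (le_lt_trans (leeD hle Hd)); rewrite -EFinD lte_fin.
have -> : 1 - 2^-1 = 2^-1 :> R by lra.
rewrite invrK; lra.
Qed.

(** Each parameter is to visit each finite word with each accuracy 1/(j+1). *)
Lemma countable_enumeration (L : set R) : countable L -> L !=set0 ->
  exists idx : nat -> R * seq (rat * rat) * nat, (forall i, L (idx i).1.1) /\
    forall l v j, L l -> exists i, idx i = (l, v, j).
Proof.
move=> /pfcard_geP[->|[f]] => [[x []]|_].
pose dec (c : nat * seq (rat * rat) * nat) := (f c.1.1, c.1.2, c.2).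
exists (fun i => dec (odflt (0%N, [::], 0%N) (unpickle i))); split.
  by move=> i; exact: funS.
move=> l v j Ll; have [n _ <-] := @surj _ _ _ _ f l Ll.
by exists (pickle (n, v, j)); rewrite pickleK.
Qed.

(** The i-th triple (la i, v i, j) of the enumeration receives the blocks of the
    i-th family. With sigma^4 a >= a0, the spacing N i is chosen so large that the
    rest of the sequence disturbs the visits by at most 1/(j+1), up to a constant
    that does not depend on i. *)
Lemma common_FHC_exists (L : set R) (a0 a b C : R) : countable L -> L !=set0 ->
  0 < a0 -> a0 < a -> 0 <= C -> (forall n, `|W n|^-1 <= C * a0 ^+ n) ->
  (forall l, L l -> a <= l <= b) ->
  exists x, forall l, L l -> FHC R (scaled l) x.
Proof.
move=> cL L0 a0_gt0 a0a C0 WC Lab.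
have a_gt0 : 0 < a by exact: lt_trans a0a.
have [idx [idxL idx_surj]] := countable_enumeration cL L0.
pose la i := (idx i).1.1; pose v i := word (idx i).1.2.
pose eta i : R := (idx i).2.+1%:R^-1.
have eta0 i : 0 < eta i by rewrite invr_gt0.
have eta1 i : eta i <= 1 by rewrite invf_le1// ler1n.
have [s [s0 s1 sE]] : exists s : R, [/\ 0 < s, s < 1 & a0 <= s ^+ 4 * a].
  have [|t t1 tE] := @exists_root_gt1 R (a / a0) 3; first by rewrite ltr_pdivlMr ?mul1r.
  have t0 : 0 < t by exact: lt_trans t1.
  exists t^-1; rewrite invr_gt0 invf_lt1//; split=> //.
  by rewrite exprVn tE invf_div mulfVK// gt_eqF.
have s01 : 0 < s < 1 by rewrite s0.
have [q [q3 qE]] : exists q, (3 <= q)%N /\ (b / a0) ^+ 2 * s ^+ q <= 1.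
  have [|q Hq] := @geometric_eventually_le R ((b / a0) ^+ 2) s 1 _ ltr01; first by rewrite ltW.
  by exists (maxn 3 q); rewrite leq_maxl Hq ?leq_maxr.
have boundM i : exists M, 0 <= M /\ forall t, modulus (v i)`_t * a0 ^+ t <= M * s ^+ t.
  have [||M M0 HM] := @finite_support_geometric R (fun t => modulus (v i)`_t * a0 ^+ t)
    s (size (v i)) s0; [| |by exists M].
  - by move=> n; rewrite mulr_ge0 ?modulus_ge0 ?exprn_ge0 ?ltW.
  - by move=> n vn; rewrite nth_default// modulus0 mul0r.
have {boundM}[M /= HM] := choice boundM.
have boundN i : exists N,
    [/\ (size (v i) <= N)%N, (0 < N)%N, s ^+ N * M i <= eta i & s ^+ N <= eta i].
  have [|N1 H1] := @geometric_eventually_le R (M i) s _ _ (eta0 i); first by rewrite ltW.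
  have [|N2 H2] := @geometric_eventually_le R 1 s _ _ (eta0 i); first by rewrite ltW.
  exists (maxn (maxn (size (v i)) 1) (maxn N1 N2)); split.
  - by rewrite !leq_max leqnn.
  - by rewrite !leq_max orbT.
  - by rewrite mulrC H1// !leq_max leqnn !orbT.
  - by rewrite -[leLHS]mul1r H2// !leq_max leqnn !orbT.
have {boundN}[N /= HN] := choice boundN.
have la_ab i : a <= la i <= b by exact/Lab/idxL.
have vM i : forall t, modulus (v i)`_t * a0 ^+ t <= M i * s ^+ t by case: (HM i).
have vN i : (size (v i) <= N i)%N by case: (HN i).
have N0 i : (0 < N i)%N by case: (HN i).
have NM i : s ^+ N i * M i <= eta i by case: (HN i).
have Neta i : s ^+ N i <= eta i by case: (HN i).
pose z := block_seq q la v N.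
have W_le n r : modulus ((of_real k (W n))^-1 * r) <= C * (modulus r * a0 ^+ n).
  by rewrite modulusM modulusV modulus_of_real mulrC [leRHS]mulrCA ler_wpM2l ?modulus_ge0.
have z_lp : (fun n => (of_real k (W n))^-1 * z n) \in lp_pred p1.
  apply: (geometric_in_lp C0 s01) => n; rewrite (le_trans (W_le _ _))// ler_wpM2l//.
  exact: (block_seq_decay a0_gt0 s0 s1 sE la_ab q3 vM NM eta1).
exists (Lp z_lp) => l Ll; apply/FHCP => y e e0.
have e2 : 0 < e / 2 by rewrite divr_gt0.
have [u yu [vu uE]] := words_dense y e2.
have d0 : 0 < 1 - s by rewrite subr_gt0.
have [j Hj] : exists j : nat, C / (1 - s) * j.+1%:R^-1 <= e / 2.
  have Cs0 : 0 <= C / (1 - s) / (e / 2) by rewrite !divr_ge0 ?(ltW d0) ?(ltW e0).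
  exists (Num.Def.archi_bound (C / (1 - s) / (e / 2))).
  rewrite ler_pdivrMr ?ltr0n// -ler_pdivrMl// [leLHS]mulrC.
  by rewrite ltW// (lt_trans (archi_boundP Cs0))// ltr_nat.
have [i iE] := idx_surj l vu j Ll.
have q1 : (1 < q)%N by exact: ltn_trans q3.
apply: lower_density_gt0_sub (block_times_density i q1 (N0 i) (leqnn (N i)) R) => n En /=.
rewrite -(subrK u y) -addrA (le_lt_trans (nrmD _ _))// [ltRHS]splitr ltr_leD//.
apply: le_trans Hj; rewrite mulrAC; apply: (nrm_geometric _ s01) => [|t].
  by rewrite mulr_ge0 ?invr_ge0.
have l_gt0 : 0 < l by have /andP[+ _] := Lab _ Ll; exact: lt_le_trans.
have -> : (u - iter n (scaled l) (Lp z_lp) : lp) t =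
    (of_real k (W t))^-1 * - (of_real k (l ^+ n) * z (n + t)%N - (v i)`_t).
  rewrite -[LHS]/(u t - iter n (scaled l) (Lp z_lp) t) iter_scaled_shift// uE /v iE/=.
  have D0 : of_real k (W (n + t)) != 0 by rewrite -modulus_gt0 modulus_of_real normr_gt0 weight_prod_neq0.
  rewrite !of_realM of_realV opprB mulrBr; congr (_ - _).
  by rewrite [RHS]mulrCA -!mulrA; congr (_ * _); rewrite mulrCA mulVKf.
rewrite (le_trans (W_le _ _))// -mulrA ler_wpM2l// modulusN.
have := block_seq_visit a0_gt0 s0 s1 sE la_ab q3 qE vM vN N0 NM Neta eta1 t En.
by rewrite /la /v /eta iE.
Qed.

End construction.

(** * Relatively compact sets of parameters *)

Lemma closure_inf {R : realType} (L : set R) : has_inf L -> closure L (inf L).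
Proof.
move=> hasL B /nbhs_ballP[e /= e0 eB].
have [l Ll le] := inf_adherent e0 hasL.
exists l; split=> //; apply: eB; rewrite /ball/= ler0_norm ?subr_le0; last exact: ge_inf hasL.2 _ Ll.
by rewrite opprB ltrBlDl.
Qed.

Lemma pos_boundedP {R : realType} (L : set R) : L `<=` [set l | 0 < l] ->
  bounded_set L <-> (exists b, forall l, L l -> l <= b).
Proof.
move=> L0; split=> [/ex_strict_bound_gt0[b _ Hb]|[b Hb]].
  by exists b => l /Hb /ltW; apply: le_trans; exact: ler_norm.
exists b; split; first exact: num_real.
move=> M bM l Ll /=; rewrite gtr0_norm; last exact: L0.
by rewrite (le_trans (Hb l Ll))// ltW.
Qed.

(* In \bar R, (0%:E)^-1 = +oo. *)
Theorem corollary2p23 (R : realType) (k : scalars) (p : R) (p1 : 1 <= p)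
    (w : nat -> R) (w_neq0 : forall n, w n != 0)
    (Bw : bounded_shift k p1 w)
    (Lambda : set R) (Lambda_gt0 : Lambda `<=` [set l | 0 < l])
    (Lambda_neq0 : Lambda !=set0) :
  let B := weighted_shift Bw in
  let r := spectral_radius B in
  let rp := point_spectral_radius B in
  let I := [set l : R | ((rp%:E)^-1 < l%:E)%E] in
  let common := \bigcap_(l in Lambda) FHC R (fun x => of_real k l *: B x) in
  let two := exists l m, [/\ Lambda l, Lambda m & l != m] in
  [/\ countable Lambda /\ relatively_compact I Lambda -> common !=set0,
      ~ bounded_set Lambda \/ two /\ ((inf Lambda)%:E <= (r%:E)^-1)%E ->
        common = set0
    & rp = r -> two ->
        (common !=set0 <-> countable Lambda /\ relatively_compact I Lambda)].

Proof.
move=> B r rp I common two.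
have L0 : forall l, Lambda l -> 0 < l by exact: Lambda_gt0.
have hasL : has_inf Lambda by split=> //; exists 0 => l /L0/ltW.
have sufficient : countable Lambda /\ relatively_compact I Lambda -> common !=set0.
  move=> [cL [cptL LI]].
  have /(point_spectral_radius_decay w_neq0)[a0 [C [a0_gt0 a0a C0 WC]]] := LI _ (closure_inf hasL).
  have [b Hb] : exists b, forall l, Lambda l -> l <= b.
    have /ex_strict_bound_gt0[b _ Hb] := @compact_bounded R R^o _ cptL.
    exists b => l Ll; apply: le_trans (ltW (Hb l (@subset_closure _ Lambda l Ll))).
    exact: ler_norm.
  have [|x Hx] := common_FHC_exists w_neq0 Bw cL Lambda_neq0 a0_gt0 a0a C0 WC (b := b).
    by move=> l Ll; rewrite Hb// andbT; exact: ge_inf hasL.2 _ Ll.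
  by exists x.
have necessary : ~ bounded_set Lambda \/ two /\ ((inf Lambda)%:E <= (r%:E)^-1)%E -> common = set0.
  move=> obstr; apply/seteqP; split=> x // Hx.
  case: obstr => [unb|[twoL infr]].
    apply: (unbounded_no_common_FHC w_neq0 Lambda_gt0 Lambda_neq0 _ Hx) => M.
    apply: contrapT => nM; apply: unb; apply/(pos_boundedP Lambda_gt0); exists M => l Ll; rewrite leNgt.
    by apply/negP => Ml; apply: nM; exists l.
  exact: (inf_le_no_common_FHC w_neq0 Lambda_gt0 twoL infr Hx).
split=> // rpr twoL; split=> // -[x Hx].
have common0 : common <> set0 by move=> c0; have : common x by []; rewrite c0.
split; first exact: (common_FHC_countable w_neq0 Lambda_gt0 Hx).
have /(pos_boundedP Lambda_gt0)[b Hb] : bounded_set Lambda.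
  by apply: contrapT => unb; apply: common0; apply: necessary; left.
have infI : I (inf Lambda).
  rewrite /I/= rpr ltNge; apply/negP => infr; apply: common0; apply: necessary; right; by split.
have clL : closure Lambda `<=` `[inf Lambda, b].
  rewrite (closure_id `[inf Lambda, b]).1; last exact: itv_closed.
  apply: closureS => l Ll; rewrite /= in_itv/= Hb// andbT; exact: ge_inf hasL.2 _ Ll.
split; first exact: subclosed_compact (@closed_closure _ _) (@segment_compact _ _ _) clL.
move=> l /clL; rewrite /= in_itv/= => /andP[infl _].
by apply: lt_le_trans infI _; rewrite lee_fin.
Qed.
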